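(* Let $\Gamma\subset U(2)$ be an admissible subgroup. For every integer $N\ge 2N(\Gamma)-1$, there is a non-constant smooth CR mapping $f:S^{3}/\Gamma\to S^{2N-1}$ (that is, a non-constant smooth CR mapping $f:S^{3}\to S^{2N-1}$ with $f\circ\gamma=f$ for all $\gamma\in\Gamma$) for which $N$ is the minimal embedding dimension.
   Context: $S^{3}$ denotes the unit sphere in $\mathbb{C}^2$, $S^{2N-1}$ the unit sphere in $\mathbb{C}^N$, and $U(2)$ the unitary group acting on $\mathbb{C}^2$. A CR mapping $f:S^{3}/\Gamma\to S^{2N-1}$ means a CR mapping $f:S^{3}\to S^{2N-1}\subset\mathbb{C}^N$ that is $\Gamma$-invariant, i.e. $f\circ\gamma=f$ for all $\gamma\in\Gamma$. Admissible subgroups: a finite subgroup $\Gamma$ of $U(2)$ is called admissible if it is equivalent (conjugate in $U(2)$) to one of the following cyclic groups: (i) $\langle \omega I_2\rangle$, where $\omega$ is a primitive $p$-th root of unity; (ii) $\langle \omega I_1\oplus\omega^2 I_1\rangle$, i.e. the group generated by $\mathrm{diag}(\omega,\omega^2)$, where $\omega$ is a primitive $p$-th root of unity with $p$ odd. The number $N(\Gamma)$: define the real-valued $\Gamma$-invariant polynomial $$\Phi_\Gamma(z,\bar z)=1-\prod_{\gamma\in\Gamma}\bigl(1-\langle\gamma z,z\rangle\bigr)=\sum_{\alpha,\beta}c_{\alpha\beta}z^\alpha\bar z^\beta,$$ where $\langle\cdot,\cdot\rangle$ is the standard Hermitian inner product on $\mathbb{C}^2$ and $\alpha,\beta$ are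 multi-indices. The coefficient matrix $(c_{\alpha\beta})$ is Hermitian. Let $N^+(\Gamma)$ and $N^-(\Gamma)$ be its numbers of positive and negative eigenvalues, counted with multiplicity, and set $N(\Gamma)=N^+(\Gamma)+N^-(\Gamma)$, the rank of $(c_{\alpha\beta})$. Minimal embedding dimension: $N$ is the minimal embedding dimension for $f=(f_1,\dots,f_N):S^{3}\to S^{2N-1}\subset\mathbb{C}^N$ if the components $f_1,\dots,f_N$ are linearly independent over $\mathbb{C}$, equivalently if the image of $f$ is not contained in any proper complex linear subspace of $\mathbb{C}^N$. *)

(* Defs.v *)
From HB Require Import structures.
From mathcomp Require Import all_boot all_order all_algebra.
From mathcomp Require Import complex finmap.
From mathcomp Require Import all_classical all_reals all_analysis.
(* The notations of mpoly clash with those of MathComp-Analysis, hence the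
   filtered import and the qualified names below. *)
From mathcomp Require Import (canonicals, coercions) mpoly.

Set Implicit Arguments.
Unset Strict Implicit.
Unset Printing Implicit Defensive.

Import Order.TTheory GRing.Theory Num.Theory numFieldNormedType.Exports.

Local Open Scope classical_set_scope.
Local Open Scope ring_scope.

Section Smooth.
Context {R : realType} {V W : normedModType R}.

(* For finite-dimensional V and open U this is the usual class C^k(U): all
   iterated directional derivatives of order <= k exist and are continuous. *)
Fixpoint Ck_on (k : nat) (U : set V) (g : V -> W) : Prop :=
  (forall p, U p -> {for p, continuous g}) /\
  if k is k'.+1 then
    forall v, (forall p, U p -> derivable g p v) /\ Ck_on k' U (fun p => 'D_v g p)
  else True.

Definition smooth_on (U : set V) (g : V -> W) : Prop := forall k, Ck_on k U g.

End Smooth.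

Section CR.
Context {R : realType}.
Local Notation C := R[i].

Definition hdot n (z w : 'cV[C]_n) : C := \sum_j z j 0 * (w j 0)^*.

(* unit sphere S^{2n-1} of C^n *)
Definition sphere n : set 'cV[C]_n := [set z | hdot z z = 1].

(* R[i] carries no normed R-space structure, so calculus on C^n is done on the
   underlying real space R^n x R^n, through (x, y) |-> x + iy. *)
Local Notation realspace n := ('cV[R]_n * 'cV[R]_n)%type.

Definition cplx n (p : realspace n) : 'cV[C]_n :=
  \col_j (p.1 j 0 +i* p.2 j 0)%C.

Definition Csmooth_on n (U : set (realspace n)) (F : realspace n -> C) : Prop :=
  smooth_on U (fun p => complex.Re (F p)) /\
  smooth_on U (fun p => complex.Im (F p)).

Definition Cderive n (v : realspace n) (F : realspace n -> C)
    (p : realspace n) : C :=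
  ('D_v (fun q => complex.Re (F q)) p +i* 'D_v (fun q => complex.Im (F q)) p)%C.

(* d/d(conj z_j) = (d/dx_j + i d/dy_j) / 2 *)
Definition dbar n (j : 'I_n) (F : realspace n -> C) (p : realspace n) : C :=
  2%:R^-1 * (Cderive (delta_mx j 0, 0) F p + 'i%C * Cderive (0, delta_mx j 0) F p).

(* A (0,1)-vector \sum_j a_j d/d(conj z_j) is tangent to the sphere at z iff it
   kills |z|^2, i.e. iff \sum_j a_j z_j = 0. *)
Definition tangential_CR n (F : realspace n -> C) (p : realspace n) : Prop :=
  forall a : 'cV[C]_n, \sum_j a j 0 * cplx p j 0 = 0 ->
    \sum_j a j 0 * dbar j F p = 0.

(* Smoothness on the sphere means having smooth local extensions F; the
   equations only involve tangential derivatives, hence do not depend on F.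
   Only the values of g on the sphere matter. *)
Definition smooth_CR_function n (g : 'cV[C]_n -> C) : Prop :=
  forall p, sphere (cplx p) ->
    exists (U : set (realspace n)) (F : realspace n -> C),
      [/\ open U, U p, Csmooth_on U F,
          forall q, U q -> sphere (cplx q) -> F q = g (cplx q)
        & forall q, U q -> sphere (cplx q) -> tangential_CR F q].

(* smooth CR mappings from S^{2n-1} to S^{2N-1} *)
Definition smooth_CR_map n N (f : 'cV[C]_n -> 'cV[C]_N) : Prop :=
  (forall z, sphere z -> sphere (f z)) /\
  (forall i, smooth_CR_function (fun z => f z i 0)).

Definition nonconstant_on_sphere n N (f : 'cV[C]_n -> 'cV[C]_N) : Prop :=
  exists z w, [/\ sphere z, sphere w & f z <> f w].

(* N is the minimal embedding dimension: the components of f are linearly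
   independent as functions on the sphere. *)
Definition minimal_embedding n N (f : 'cV[C]_n -> 'cV[C]_N) : Prop :=
  forall c : 'cV[C]_N,
    (forall z, sphere z -> \sum_i c i 0 * f z i 0 = 0) -> c = 0.

End CR.

Section Groups.
Context {R : realType}.
Local Notation C := R[i].
Implicit Type G : {fset 'M[C]_2}.

Definition finite_subgroup_U2 G : Prop :=
  [/\ 1%:M \in G,
      {in G &, forall A B, A *m B \in G},
      {in G, forall A, invmx A \in G}
    & {in G, forall A, A \is unitarymx}].

Definition cyclic_gen (g : 'M[C]_2) : set 'M[C]_2 := range (fun k : int => g ^ k).

Definition U2_conjugate G (H : set 'M[C]_2) : Prop :=
  exists2 P : 'M[C]_2, P \is unitarymx &
    [set` G] = [set P *m A *m invmx P | A in H].

Definition admissible G : Prop :=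
  finite_subgroup_U2 G /\
  exists (p : nat) (w : C), p.-primitive_root w /\
    (U2_conjugate G (cyclic_gen w%:M) \/
     odd p /\
     U2_conjugate G (cyclic_gen (diag_mx (\row_(j < 2) w ^+ j.+1)))).

(* Polynomials in z, conj z with conj z formally independent of z: the outer
   variables are conj z_0, conj z_1, the inner ones are z_0, z_1. *)
Definition zzbar_poly : comNzRingType := mpoly.mpoly 2 (mpoly.mpoly 2 C).

Definition zvar (j : 'I_2) : mpoly.mpoly 2 C := mpoly.mpolyX C (mpoly.mnm1 j).
Definition zbarvar (j : 'I_2) : zzbar_poly :=
  mpoly.mpolyX (mpoly.mpoly 2 C) (mpoly.mnm1 j).

(* < g z, z > *)
Definition act_form (g : 'M[C]_2) : zzbar_poly :=
  \sum_j mpoly.mpolyC 2 (\sum_k g j k *: zvar k) * zbarvar j.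

Definition Phi G : zzbar_poly := 1 - \prod_(g <- G) (1 - act_form g).

(* Both multi-indices of the monomials of Phi G have degree at most |G|, so the
   matrix (c_{alpha beta}) is truncated to the multi-indices of degree <= |G|;
   this only drops zero rows and columns. *)
Definition midx G : finType := mpoly.bmultinom 2 #|` G|.+1.

Definition coefmx G : 'M[C]_#|midx G| :=
  \matrix_(a, b) mpoly.mcoeff (mpoly.bmnm (enum_val a))
    (mpoly.mcoeff (mpoly.bmnm (enum_val b)) (Phi G)).

(* eigenvalues, repeated according to their multiplicity *)
Definition eigenvalues n (A : 'M[C]_n) : seq C :=
  sval (closed_field_poly_normal (char_poly A)).

Definition Nplus G : nat := count (fun a => 0 < a) (eigenvalues (coefmx G)).
Definition Nminus G : nat := count (fun a => a < 0) (eigenvalues (coefmx G)).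
Definition NGamma G : nat := (Nplus G + Nminus G)%N.

End Groups.

(* Main.v *)
Require Import Defs.
From mathcomp Require Import all_boot all_order all_algebra.
From mathcomp Require Import complex finmap.
From mathcomp Require Import zify ring lra.
From mathcomp Require Import all_classical all_reals all_analysis.
From mathcomp Require Import (canonicals, coercions) mpoly.

(** The group is conjugate to the cyclic group generated by
    [D = diag(w^e_0, w^e_1)], with [(e_0, e_1) = (1, 1)] or [(1, 2)], say by
    the unitary matrix [P].  Let [u] denote the coordinates of [invmx P *m z].

    The maps are monomial in [u]: the map with components [sqrt(c_a) u^a], [a]
    in a finite set [s] of exponents, sends the sphere to the sphere as soon
    as [sum_(a in s) c_a x^(a_1) y^(a_2) = 1] whenever [x + y = 1].  It is
    polynomial, hence smooth and CR; it is invariant if [p] divides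
    [e_0 a_1 + e_1 a_2] for all [a] in [s]; its components are linearly
    independent on the sphere because they are distinct monomials
    ([monomial_map_minimal]), and this forces it to be non-constant
    ([nonconstant_minimal]).  What remains is a combinatorial question: which
    numbers are the size of such a set [s]?

    Everything is built from one polynomial [F(x, y)] with nonnegative
    coefficients, equal to 1 on the line and with invariant exponents: [(x + y)^p]
    for weights [(1, 1)], and [L_p(x, y) + y^p] for weights [(1, 2)] and [p]
    odd, where [L_p] is the Lucas polynomial.  Let [m] be its number of
    monomials, [p + 1] and [(p + 3) / 2] respectively.

    The number [m] bounds N(Gamma) from below.  Indeed
    [prod_k (1 - w^(k e_0) x - w^(k e_1) y) = 1 - F(x, y)] holds in every
    commutative ring: for the weights [(1, 2)] the left side is
    [det (1 - M^p)] with [M] the companion matrix of [t^2 - x t - y]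
    ([prod_one_sub_lucas]).  Taking [x = |u_1|^2] and [y = |u_2|^2] writes
    Phi as a sum of squares [|u^a|^2] over the monomials of [F], so its
    coefficient matrix is a Gram matrix, hermitian and of rank at least [m]
    ([coefmx_gram], [rank_gram_ge]).

    Conversely every [N >= 2 m - 1] is a size.  Replacing a term [t] of a
    family by [t F] keeps the sum equal to 1 on the line ([unital_tensor]).
    Doing so with the highest power of [x] replaces one exponent by [m] new
    ones, hence turns the size [n] into [n + m - 1] ([tensor_x_top]); it is
    therefore enough to reach the [m - 1] sizes starting from [2 m - 1]
    ([unital_sizes]).  They come from tensoring several terms of [F] at once,
    because the resulting monomials overlap heavily ([unital_binom_sizes],
    [unital_lucas_sizes]). *)

Set Implicit Arguments.
Unset Strict Implicit.
Unset Printing Implicit Defensive.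

Import Order.TTheory GRing.Theory Num.Theory numFieldNormedType.Exports.

Local Open Scope classical_set_scope.
Local Open Scope ring_scope.

(** * Families of exponents with positive weights summing to 1 on x + y = 1 *)

Notation expo := (nat * nat)%type.

Definition expo_add (a b : expo) : expo := (a.1 + b.1, a.2 + b.2)%N.

Definition monval (A : comNzRingType) (x y : A) (a : expo) : A := x ^+ a.1 * y ^+ a.2.

Lemma monval_add (A : comNzRingType) (x y : A) a b :
  monval x y (expo_add a b) = monval x y a * monval x y b.
Proof. by rewrite /monval /= !exprD; ring. Qed.

Lemma rmorph_monval (A B : comNzRingType) (f : {rmorphism A -> B}) (x y : A) a :
  f (monval x y a) = monval (f x) (f y) a.
Proof. by rewrite /monval rmorphM !rmorphXn. Qed.

Lemma monval_mul (A : comNzRingType) (x y x' y' : A) a :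
  monval (x * x') (y * y') a = monval x y a * monval x' y' a.
Proof. by rewrite /monval !exprMn mulrACA. Qed.

Definition msum (A : comNzRingType) (F : seq expo) (x y : A) : A :=
  \sum_(a <- F) monval x y a.

Section Unital.
Variable R : realFieldType.

(** Positive weights on [s] summing to 1 over monomials, on the line
    [x + y = 1]: with [x = |z_1|^2] and [y = |z_2|^2], this is what the
    squared moduli of the components of a monomial sphere map do.  The witness
    [l] may repeat an exponent, so that sums and products of such families are
    plain concatenations; [unital_weights] merges the repetitions. *)
Definition unital (s : seq expo) : Prop :=
  exists l : seq (expo * R), [/\ all (fun t => 0 < t.2) l,
    [seq t.1 | t <- l] =i s
    & forall x y : R, x + y = 1 -> \sum_(t <- l) t.2 * monval x y t.1 = 1].

Lemma unital_eq s s' : s =i s' -> unital s -> unital s'.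
Proof. by move=> e [l [l0 ls l1]]; exists l; split=> // a; rewrite ls. Qed.

Lemma unital_msum (F : seq expo) :
  (forall x y : R, x + y = 1 -> msum F x y = 1) -> unital F.
Proof.
move=> F1; exists [seq (a, 1) | a <- F]; split.
- by rewrite all_map; apply/allP => a _ /=; apply: ltr01.
- by move=> a; rewrite -map_comp map_id.
- move=> x y xy; rewrite big_map -[RHS](F1 x y xy); apply: eq_bigr => a _.
  by rewrite /= mul1r.
Qed.

(** Average the two families. *)
Lemma unital_union s s' : unital s -> unital s' -> unital (s ++ s').
Proof.
move=> [l [l0 ls l1]] [l' [l0' ls' l1']].
exists [seq (t.1, t.2 / 2) | t <- l ++ l']; split.
- rewrite all_map; apply/allP => t; rewrite mem_cat /= => /orP[] tl.
    by have := allP l0 t tl; lra.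
  by have := allP l0' t tl; lra.
- by move=> a; rewrite -map_comp map_cat !mem_cat -ls -ls'.
- move=> x y xy; rewrite big_map big_cat /=.
  have h (r : seq (expo * R)) : \sum_(t <- r) t.2 / 2 * monval x y t.1 =
    (\sum_(t <- r) t.2 * monval x y t.1) / 2.
    by rewrite mulr_suml; apply: eq_bigr => t _; ring.
  by rewrite !h l1 // l1' //; lra.
Qed.

(** The exponents left after the terms of [s] in [S] are multiplied by the
    family [u].  For sphere maps this is the partial tensor product. *)
Definition tensor (S : pred expo) (s u : seq expo) : seq expo :=
  [seq a <- s | ~~ S a] ++ [seq expo_add a b | a <- [seq a <- s | S a], b <- u].

(** The family [u] sums to 1, so multiplying some terms by it changes
    nothing on the line. *)
Lemma unital_tensor S s u : unital s -> unital u -> unital (tensor S s u).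
Proof.
move=> [l [l0 ls l1]] [k [k0 ks k1]].
exists ([seq t <- l | ~~ S t.1] ++
   [seq (expo_add t.1 v.1, t.2 * v.2) | t <- [seq t <- l | S t.1], v <- k]); split.
- rewrite all_cat; apply/andP; split.
    by apply/allP => t; rewrite mem_filter => /andP[_]; apply: (allP l0).
  apply/allP => _ /allpairsP[[t v] /= [+ vk ->]] /=.
  rewrite mem_filter => /andP[_ tl].
  by rewrite mulr_gt0 ?(allP l0 t tl) ?(allP k0 v vk).
- move=> a; rewrite map_cat !mem_cat; congr (_ || _).
    rewrite mem_filter -ls; apply/mapP/andP.
      move=> [t]; rewrite mem_filter => /andP[St tl] ->; split=> //.
      by apply: map_f.
    by move=> [Sa /mapP[t tl ea]]; exists t; rewrite // mem_filter -ea Sa.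
  apply/mapP/allpairsP => [[_ /allpairsP[[t v] /= [+ vk ->]] ->]|].
    rewrite mem_filter => /andP[St tl]; exists (t.1, v.1) => /=; split=> //.
      by rewrite mem_filter St -ls map_f.
    by rewrite -ks map_f.
  move=> [[b c] /= [+ + ->]]; rewrite mem_filter -ls -ks.
  move=> /andP[Sb /mapP[t tl eb]] /mapP[v vk ec].
  exists (expo_add t.1 v.1, t.2 * v.2); rewrite ?eb ?ec //.
  by apply/allpairsP; exists (t, v); rewrite mem_filter -eb Sb.
- move=> x y xy; rewrite big_cat /= big_allpairs_dep /= !big_filter.
  rewrite -[RHS](l1 x y xy) [RHS](bigID (fun t => S t.1)) /= addrC; congr (_ + _).
  apply: eq_bigr => t _; rewrite -[RHS]mulr1 -(k1 x y xy) mulr_sumr.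
  by apply: eq_bigr => v _; rewrite monval_add; ring.
Qed.

Lemma unital_weights s : uniq s -> unital s ->
  exists c : expo -> R, {in s, forall a, 0 < c a} /\
    forall x y, x + y = 1 -> \sum_(a <- s) c a * monval x y a = 1.
Proof.
move=> us [l [l0 ls l1]].
exists (fun a => \sum_(t <- l | t.1 == a) t.2); split.
  move=> a; rewrite -ls => /mapP[t tl ->].
  rewrite (big_rem t) //= eqxx ltr_pwDl ?(allP l0 t tl) //.
  rewrite big_seq_cond; apply: sumr_ge0 => v /andP[vl _].
  by apply/ltW/(allP l0)/(mem_rem vl).
move=> x y xy; rewrite -(l1 x y xy).
under eq_bigr => a _ do rewrite mulr_suml big_mkcond /=.
rewrite exchange_big /= [LHS]big_seq [RHS]big_seq; apply: eq_bigr => t tl.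
rewrite (bigD1_seq t.1) //=; last by rewrite -ls map_f.
by rewrite eqxx big1 ?addr0 // => a /negbTE; rewrite eq_sym => ->.
Qed.

(** The pure power of [x] is strictly dominant: every other exponent has
    smaller x-degree, so multiplying this power by a monomial never meets
    another exponent. *)
Definition x_topped (d : nat) (s : seq expo) : Prop :=
  (d, 0%N) \in s /\ forall a : expo, a \in s -> a != (d, 0%N) -> (a.1 < d)%N.

(** Tensoring the top power of [x] by [F] replaces one exponent by [size F]
    new ones, and the top power of [F] makes the result topped again. *)
Lemma tensor_x_top (L : pred expo) (F s : seq expo) (p d : nat) : (0 < p)%N ->
  (forall a b, L a -> L b -> L (expo_add a b)) ->
  uniq F -> unital F -> x_topped p F -> all L F ->
  uniq s -> unital s -> x_topped d s -> all L s ->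
  exists s', [/\ uniq s', unital s', x_topped (d + p) s', all L s' &
     size s' = (size s + size F).-1].
Proof.
move=> p0 Ladd uF F1 [Ftop Fd] LF us s1 [stop sd] Ls.
pose s' := rem (d, 0%N) s ++ [seq expo_add (d, 0%N) b | b <- F].
have mem_rem a : (a \in rem (d, 0%N) s) = (a != (d, 0%N)) && (a \in s).
  by rewrite mem_rem_uniq.
have ins' a : (a \in s') = (a != (d, 0%N)) && (a \in s) ||
   (a \in [seq expo_add (d, 0%N) b | b <- F]) by rewrite mem_cat mem_rem.
have adj : injective (expo_add (d, 0%N)).
  by move=> [a b] [a' b'] [/addnI -> /addnI ->].
exists s'; split.
- rewrite cat_uniq rem_uniq //= map_inj_uniq // uF andbT.
  apply/hasPn => _ /mapP[b bF ->]; rewrite mem_rem; apply/andP => -[n0 ins].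
  by have /= := sd _ ins n0; lia.
- apply: unital_eq (unital_tensor (pred1 (d, 0%N)) s1 F1) => a.
  rewrite ins' /tensor mem_cat mem_filter /=; congr (_ || _).
  by rewrite filter_pred1_uniq //= cats0.
- split; first by rewrite ins'; apply/orP; right; apply/mapP; exists (p, 0%N).
  move=> a; rewrite ins' => /orP[/andP[an ins] _|/mapP[b bF ->] /= bn].
    by have := sd _ ins an; lia.
  have : b != (p, 0%N) by apply: contra bn => /eqP ->.
  by move=> bnp; rewrite ltn_add2l (Fd _ bF).
- apply/allP => a; rewrite ins' => /orP[/andP[_]|/mapP[b bF ->]]; first exact: (allP Ls).
  by apply: Ladd; [apply: (allP Ls) | apply: (allP LF)].
- rewrite size_cat size_map size_rem //.
  by case: (s) stop => //= *; lia.
Qed.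

(** As [tensor_x_top] adds [(size F).-1] exponents, that many consecutive
    sizes are enough to start an induction reaching all larger ones. *)
Lemma unital_sizes (L : pred expo) (F : seq expo) (p n : nat) : (0 < p)%N ->
  (1 < size F)%N ->
  (forall a b, L a -> L b -> L (expo_add a b)) ->
  uniq F -> unital F -> x_topped p F -> all L F ->
  (forall k, (k < (size F).-1)%N -> exists s d,
     [/\ uniq s, unital s, x_topped d s, all L s & size s = (n + k)%N]) ->
  forall N, (n <= N)%N -> exists s, [/\ uniq s, unital s, all L s & size s = N].
Proof.
move=> p0 F2 Ladd uF F1 Ftop LF base N nN.
suff [s [d [us s1 st Ls sN]]] : exists s d,
   [/\ uniq s, unital s, x_topped d s, all L s & size s = N] by exists s.
elim/ltn_ind: N nN => N IH nN.
have [kN|kN] := ltnP (N - n) (size F).-1.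
  by have := base _ kN; rewrite subnKC.
have [||s [d [us s1 st Ls sN]]] := IH (N - (size F).-1)%N; try lia.
have [s' [us' s1' st' Ls' sN']] := tensor_x_top p0 Ladd uF F1 Ftop LF us s1 st Ls.
by exists s', (d + p)%N; split=> //; rewrite sN' sN; lia.
Qed.
End Unital.

Definition shiftx := map (expo_add (1, 0)%N).
Definition shifty := map (expo_add (0, 1)%N).

(** Both lists spell polynomials with nonnegative coefficients as sums of
    monomials, with repetitions: [(x + y) ^+ n] here, and below the Lucas
    polynomial [L_n], which is [a ^+ n + b ^+ n] when [a + b = x] and
    [a * b = - y]. *)
Fixpoint binom_terms n : seq expo :=
  if n is n1.+1 then shiftx (binom_terms n1) ++ shifty (binom_terms n1)
  else [:: (0, 0)%N].

Fixpoint lucas_terms n : seq expo :=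
  if n is n1.+1 then
    if n1 is n2.+1 then shiftx (lucas_terms n1) ++ shifty (lucas_terms n2)
    else [:: (1, 0)%N]
  else [:: (0, 0)%N; (0, 0)%N].

Lemma msum_cat (A : comNzRingType) (x y : A) F G :
  msum (F ++ G) x y = msum F x y + msum G x y.
Proof. exact: big_cat. Qed.

Lemma msum_shiftx (A : comNzRingType) (x y : A) F :
  msum (shiftx F) x y = x * msum F x y.
Proof.
rewrite /msum big_map mulr_sumr; apply: eq_bigr => a _.
by rewrite monval_add /monval /= expr1 expr0 mulr1.
Qed.

Lemma msum_shifty (A : comNzRingType) (x y : A) F :
  msum (shifty F) x y = y * msum F x y.
Proof.
rewrite /msum big_map mulr_sumr; apply: eq_bigr => a _.
by rewrite monval_add /monval /= expr1 expr0 mul1r.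
Qed.

Lemma msum_binom (A : comNzRingType) (x y : A) n :
  msum (binom_terms n) x y = (x + y) ^+ n.
Proof.
elim: n => [|n IH]; first by rewrite /msum big_seq1 /monval !expr0 mulr1.
by rewrite /= msum_cat msum_shiftx msum_shifty IH exprS; ring.
Qed.

Lemma lucasSS n :
  lucas_terms n.+2 = shiftx (lucas_terms n.+1) ++ shifty (lucas_terms n).
Proof. by []. Qed.

(** On the line, [a = 1] and [b = - y]. *)
Lemma msum_lucas_line (A : comNzRingType) (x y : A) n : x + y = 1 ->
  msum (lucas_terms n) x y = 1 + (- y) ^+ n.
Proof.
move=> xy; have -> : x = 1 - y by rewrite -xy; ring.
elim/ltn_ind: n => -[|[|n]] IH.
- by rewrite /msum big_cons big_seq1 /monval !expr0 mulr1.
- by rewrite /msum big_seq1 /monval /= expr1 expr0 mulr1.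
- by rewrite lucasSS msum_cat msum_shiftx msum_shifty !IH // !exprS; ring.
Qed.

Lemma mem_shiftx F a b : ((a, b) \in shiftx F) = (0 < a)%N && ((a.-1, b) \in F).
Proof.
apply/mapP/andP => [[[c d] cF [-> ->]]|[a0 aF]]; first by rewrite add0n.
by exists (a.-1, b); rewrite // /expo_add /= add0n add1n prednK.
Qed.

Lemma mem_shifty F a b : ((a, b) \in shifty F) = (0 < b)%N && ((a, b.-1) \in F).
Proof.
apply/mapP/andP => [[[c d] cF [-> ->]]|[a0 aF]]; first by rewrite add0n.
by exists (a, b.-1); rewrite // /expo_add /= add0n add1n prednK.
Qed.

Lemma mem_binom n a b : ((a, b) \in binom_terms n) = (a + b == n)%N.
Proof.
elim: n a b => [|n IH] a b; first by rewrite inE xpair_eqE addn_eq0.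
by rewrite mem_cat mem_shiftx mem_shifty !IH; lia.
Qed.

Lemma mem_lucas n a b : ((a, b) \in lucas_terms n) = (a + 2 * b == n)%N.
Proof.
elim/ltn_ind: n a b => -[|[|n]] IH a b.
- by rewrite !inE xpair_eqE; lia.
- by rewrite !inE xpair_eqE; lia.
- by rewrite lucasSS mem_cat mem_shiftx mem_shifty !IH //; lia.
Qed.

Lemma mem_allpairs_expo_add (s u : seq expo) a b :
  reflect (exists c d : expo, [/\ c \in s, d \in u, a = c.1 + d.1 & b = c.2 + d.2]%N)
    ((a, b) \in [seq expo_add c d | c <- s, d <- u]).
Proof.
apply: (iffP allpairsP) => [[[c d] /= [cs du [-> ->]]]|[c [d [cs du -> ->]]]].
  by exists c, d.
by exists (c, d).
Qed.

Lemma mem_map_curve (f g : nat -> nat) (a b m n : nat) :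
  reflect (exists2 j, (m <= j < m + n)%N & a = f j /\ b = g j)
    ((a, b) \in [seq (f j, g j) | j <- iota m n]).
Proof.
apply: (iffP mapP) => [[j]|[j jmn [-> ->]]].
  by rewrite mem_iota => jmn [-> ->]; exists j.
by exists j; rewrite // mem_iota.
Qed.

Lemma curve_uniq (f : nat -> nat) m n : uniq [seq (f j, j) | j <- iota m n].
Proof. by rewrite map_inj_uniq ?iota_uniq // => i j []. Qed.

Lemma binom_exponents p : exists t : seq expo,
  [/\ uniq t, t =i binom_terms p & size t = p.+1].
Proof.
exists [seq ((p - j)%N, j) | j <- iota 0 p.+1].
split; [exact: (curve_uniq (subn p)) | | by rewrite size_map size_iota].
move=> [a b]; rewrite mem_binom; apply/mem_map_curve/idP => [[j jp [-> ->]]|ab].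
  by lia.
by exists b; lia.
Qed.

Lemma lucas_exponents p : odd p -> exists t : seq expo,
  [/\ uniq t, t =i (0, p)%N :: lucas_terms p & size t = p./2.+2].
Proof.
move=> op; have pr : p = (2 * p./2).+1.
  by rewrite -[LHS](odd_double_half p) op mul2n.
exists ((0, p)%N :: [seq ((p - 2 * j)%N, j) | j <- iota 0 p./2.+1]); split.
- rewrite cons_uniq (curve_uniq (fun j => p - 2 * j)%N) andbT.
  by apply/mem_map_curve => -[j jr []]; lia.
- move=> [a b]; rewrite in_cons [RHS]in_cons mem_lucas; congr (_ || _).
  apply/mem_map_curve/idP => [[j jp [-> ->]]|ab]; first by lia.
  by exists b; lia.
- by rewrite /= size_map size_iota.
Qed.

Section Sizes.
Variable R : realFieldType.

Lemma unital_binom p : unital R (binom_terms p).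
Proof. by apply: unital_msum => x y xy; rewrite msum_binom xy expr1n. Qed.

Lemma unital_lucas p : odd p -> unital R ((0, p)%N :: lucas_terms p).
Proof.
move=> op; apply: unital_msum => x y xy.
rewrite -cat1s msum_cat msum_lucas_line // {1}/msum big_seq1 /monval /=.
by rewrite expr0 mul1r exprNn -signr_odd op expr1; ring.
Qed.

(** Write [F] for the [p.+1] exponents of degree [p].  Tensoring only [x^p]
    leaves [p] exponents of degree [p] and creates [p.+1] of degree [2 * p];
    tensoring all of [x^p, ..., x^(p-k) y^k] creates [p + k.+1] consecutive
    ones.  The union of the two results has [2 * p + k.+1] elements, and
    [k < p] gives the [p] consecutive sizes that [unital_sizes] needs. *)
Lemma unital_binom_sizes p N : (0 < p)%N -> (2 * p.+1 - 1 <= N)%N ->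
  exists s : seq expo, [/\ uniq s, unital R s,
    all (fun a => p %| a.1 + a.2)%N s & size s = N].
Proof.
move=> p0 pN.
have [F [uF memF sF]] := binom_exponents p.
have F1 : unital R F by apply: unital_eq (unital_binom p) => a; rewrite memF.
apply: (unital_sizes (n := (2 * p.+1 - 1)%N) (p := p) (F := F)) => //.
- by rewrite sF.
- by move=> a b; rewrite /expo_add /= addnACA; apply: dvdn_add.
- split; first by rewrite memF mem_binom addn0.
  by move=> [a b]; rewrite memF mem_binom xpair_eqE /=; lia.
- by apply/allP => -[a b]; rewrite memF mem_binom => /eqP /= ->.
move=> k; rewrite sF /= => kp.
pose s : seq expo := [seq ((p - j)%N, j) | j <- iota 1 p] ++
   [seq ((2 * p - j)%N, j) | j <- iota 0 (p + k.+1)].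
have mems a b : ((a, b) \in s) =
   ((a + b == p) && (0 < b) || (a + b == 2 * p) && (b <= p + k))%N.
  rewrite mem_cat; congr (_ || _).
    apply/mem_map_curve/idP => [[j jp [-> ->]]|ab]; first by lia.
    by exists b; lia.
  apply/mem_map_curve/idP => [[j jp [-> ->]]|ab]; first by lia.
  by exists b; lia.
exists s, (2 * p)%N; split.
- rewrite cat_uniq (curve_uniq (subn p)) (curve_uniq (subn (2 * p))) andbT /=.
  apply/hasPn => -[a b] /mem_map_curve[j jp [-> ->]].
  by apply/mem_map_curve => -[i ip [h1 h2]]; lia.
- apply: unital_eq (unital_union (unital_tensor (fun a : expo => a.2 < 1)%N F1 F1)
    (unital_tensor (fun a : expo => a.2 < k.+1)%N F1 F1)) => -[a b].
  rewrite mems /tensor !mem_cat !mem_filter !memF !mem_binom /=.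
  apply/idP/idP.
    move=> /orP[/orP[|]|/orP[|]]; try lia;
    by move=> /mem_allpairs_expo_add[[c1 c2] [[d1 d2]]] [];
       rewrite mem_filter !memF !mem_binom /=; lia.
  move=> /orP[|ab]; first by lia.
  apply/orP; right; apply/orP; right; apply/mem_allpairs_expo_add.
  exists (p - minn b k, minn b k)%N, (a - (p - minn b k), b - minn b k)%N.
  by rewrite mem_filter !memF !mem_binom /=; split; lia.
- split; first by rewrite mems; lia.
  by move=> [a b]; rewrite mems xpair_eqE /=; lia.
- apply/allP => -[a b]; rewrite mems /= => /orP[/andP[/eqP -> //]|/andP[/eqP -> _]].
  by rewrite dvdn_mull.
- by rewrite size_cat !size_map !size_iota; lia.
Qed.

(** Here [F] has the exponents [x^(p - 2j) y^j], [j <= r], and [y^p], where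
    [p = 2r + 1].  Tensoring the terms with [j <= k] removes [k.+1] of them
    and creates [r + k.+1] exponents [x^(2p - 2j) y^j] and [k.+1] exponents
    [x^(p - 2j) y^(p + j)], which makes [2 * r + 3 + k]; the values [k <= r]
    give [r.+1] consecutive sizes. *)
Lemma unital_lucas_sizes p N : odd p -> (2 * p./2.+2 - 1 <= N)%N ->
  exists s : seq expo, [/\ uniq s, unital R s,
    all (fun a => p %| a.1 + 2 * a.2)%N s & size s = N].
Proof.
move=> op; set r := p./2 => pN.
have pr : p = (2 * r).+1 by rewrite -(odd_double_half p) op mul2n.
have [F [uF memF sF]] := lucas_exponents op.
have memFE a b : ((a, b) \in F) = ((a == 0) && (b == p) || (a + 2 * b == p))%N.
  by rewrite memF inE mem_lucas.
have F1 : unital R F by apply: unital_eq (unital_lucas op) => a; rewrite memF.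
apply: (unital_sizes (n := (2 * r.+2 - 1)%N) (p := p) (F := F)) => //.
- by rewrite pr.
- by rewrite sF.
- by move=> a b; rewrite /expo_add /= mulnDr addnACA; apply: dvdn_add.
- split; first by rewrite memFE; lia.
  by move=> [a b]; rewrite memFE xpair_eqE /=; lia.
- apply/allP => -[a b]; rewrite memFE /= => /orP[/andP[/eqP -> /eqP ->]|/eqP -> //].
  by rewrite dvdn_mull.
move=> k; rewrite sF /= => kr.
have [c1 [u1 z1 m1]] : exists c : seq expo, [/\ uniq c, size c = (r - k)%N &
    forall a b, ((a, b) \in c) = (a + 2 * b == p) && (k < b)]%N.
  exists [seq ((p - 2 * j)%N, j) | j <- iota k.+1 (r - k)].
  rewrite (curve_uniq (fun j => p - 2 * j)%N) size_map size_iota; split=> // a b.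
  apply/mem_map_curve/idP => [[j jp [-> ->]]|ab]; first by lia.
  by exists b; lia.
have [c2 [u2 z2 m2]] : exists c : seq expo, [/\ uniq c, size c = (r + k.+1)%N &
    forall a b, ((a, b) \in c) = (a + 2 * b == 2 * p) && (b <= r + k)]%N.
  exists [seq ((2 * p - 2 * j)%N, j) | j <- iota 0 (r + k.+1)].
  rewrite (curve_uniq (fun j => 2 * p - 2 * j)%N) size_map size_iota; split=> // a b.
  apply/mem_map_curve/idP => [[j jp [-> ->]]|ab]; first by lia.
  by exists b; lia.
have [c3 [u3 z3 m3]] : exists c : seq expo, [/\ uniq c, size c = k.+1 &
    forall a b, ((a, b) \in c) = [&& a + 2 * (b - p) == p, p <= b & b - p <= k]]%N.
  exists [seq ((p - 2 * j)%N, p + j)%N | j <- iota 0 k.+1].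
  rewrite size_map size_iota map_inj_uniq ?iota_uniq; last by move=> ? ? [_ /addnI].
  split=> // a b.
  apply/mem_map_curve/idP => [[j jp [-> ->]]|ab]; first by lia.
  by exists (b - p)%N; lia.
pose s := (0, p)%N :: c1 ++ c2 ++ c3.
have mems a b : ((a, b) \in s) =
   [|| (a == 0) && (b == p), (a + 2 * b == p) && (k < b),
    (a + 2 * b == 2 * p) && (b <= r + k) |
    [&& a + 2 * (b - p) == p, p <= b & b - p <= k]]%N.
  by rewrite in_cons !mem_cat m1 m2 m3.
exists s, (2 * p)%N; split.
- have disj (t u : seq expo) :
    (forall a b, (a, b) \in u -> (a, b) \in t -> False) -> ~~ has (mem t) u.
    by move=> tu; apply/hasPn => -[a b] /tu h; apply/negP.
  rewrite cons_uniq !cat_uniq u1 u2 u3 andbT !mem_cat m1 m2 m3 !disj /=; first by lia.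
  + by move=> a b; rewrite m2 m3; lia.
  + by move=> a b; rewrite mem_cat m1 m2 m3; lia.
- apply: unital_eq (unital_tensor (fun a : expo => a.2 < k.+1)%N F1 F1) => -[a b].
  rewrite mems mem_cat mem_filter memFE.
  apply/idP/idP.
    move=> /orP[|]; first by move=> /=; lia.
    move=> /mem_allpairs_expo_add[[a1 a2] [[d1 d2]]] [].
    by rewrite mem_filter !memFE /=; lia.
  move=> /or4P[||ab|ab]; try (move=> /=; lia).
  - apply/orP; right; apply/mem_allpairs_expo_add.
    exists (p - 2 * minn b k, minn b k)%N, (a - (p - 2 * minn b k), b - minn b k)%N.
    by rewrite mem_filter !memFE /=; split; lia.
  - apply/orP; right; apply/mem_allpairs_expo_add.
    exists (a, b - p)%N, (0, p)%N.
    by rewrite mem_filter !memFE /=; split; lia.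
- split; first by rewrite mems; lia.
  by move=> [a b]; rewrite mems xpair_eqE /=; lia.
- apply/allP => -[a b]; rewrite mems /=.
  move=> /or4P[/andP[/eqP -> /eqP ->]|/andP[/eqP -> //]|/andP[/eqP -> _]|/and3P[ab pb _]].
  + by rewrite dvdn_mull.
  + by rewrite dvdn_mull.
  + have -> : (a + 2 * b = 3 * p)%N by lia.
    by rewrite dvdn_mull.
- by rewrite /= !size_cat z1 z2 z3; lia.
Qed.
End Sizes.

(** * The product over the group in a commutative ring *)

(** Both sides have degree at most [p] and agree at 0 and at the [p] powers
    of [w], the point [w ^+ k] being a zero of the factor of index [- k]. *)
Lemma prod_one_sub_rootX (K : fieldType) (p : nat) (w : K) : p.-primitive_root w ->
  \prod_(k < p) (1 - (w ^+ k) *: 'X) = 1 - 'X^p :> {poly K}.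
Proof.
move=> wp; have p0 := prim_order_gt0 wp.
apply/eqP; rewrite -subr_eq0; set D := (X in X == 0); apply/eqP.
have wk0 (k : nat) : w ^+ k != 0.
  apply: (@expf_neq0 _ w); apply/eqP => w0; have /eqP := prim_expr_order wp.
  by rewrite w0 expr0n gtn_eqF // eq_sym oner_eq0.
apply: (@roots_geq_poly_eq0 _ _ (0 :: [seq w ^+ k | k <- iota 0 p])).
- rewrite /= ; apply/andP; split.
    rewrite rootE /D !hornerE horner_prod ?hornerXn expr0n gtn_eqF //= subr0.
    by rewrite big1 ?subrr ?eqxx // => i _;
      rewrite hornerD hornerN hornerZ hornerX hornerC mulr0 subr0.
  apply/allP => x /mapP[k]; rewrite mem_iota add0n => /andP[_ kp] ->.
  rewrite rootE /D !hornerE horner_prod ?hornerXn exprAC (prim_expr_order wp) expr1n.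
  (* The reduction modulo [p] turns the index [p - 0] into 0. *)
  have qp : ((p - k) %% p < p)%N by rewrite ltn_mod.
  rewrite (bigD1 (Ordinal qp)) //= !hornerE -(prim_expr_mod wp) ?modnDml.
  rewrite modn_mod (prim_expr_mod wp) -exprD subnK ?(ltnW kp) // (prim_expr_order wp).
  by rewrite !subrr mul0r subr0 eqxx.
- rewrite cons_uniq; apply/andP; split.
    by apply/mapP => -[k _ /eqP]; rewrite eq_sym (negbTE (wk0 k)).
  rewrite map_inj_in_uniq ?iota_uniq // => i j; rewrite !mem_iota => ip jp /eqP.
  by rewrite (eq_prim_root_expr wp) !modn_small //; move/eqP.
- rewrite /= size_map size_iota.
  apply: leq_trans (size_polyD _ _) _; rewrite geq_max size_polyN; apply/andP; split.
    apply: leq_trans (size_poly_prod_leq _ _) _.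
    have : (\sum_(i < p) size (1 - w ^+ i *: 'X)%R <= \sum_(i < p) 2)%N.
      apply: leq_sum => k _; apply: leq_trans (size_polyD _ _) _.
      by rewrite geq_max size_poly1 size_polyN size_scale ?size_polyX.
    rewrite sum_nat_const card_ord => h; rewrite leq_subLR addnS ltnS (leq_trans h) //; lia.
  apply: leq_trans (size_polyD _ _) _.
  by rewrite geq_max size_poly1 size_polyN size_polyXn leqnn.
Qed.

Lemma det_mx2 (A : comNzRingType) (B : 'M[A]_2) :
  \det B = B 0 0 * B 1 1 - B 0 1 * B 1 0.
Proof.
rewrite (expand_det_row _ 0) !big_ord_recl big_ord0 /cofactor !det_mx11 !mxE /=.
have -> : lift ord0 ord0 = 1 :> 'I_2 by apply/val_inj.
have -> : lift 1 0 = 0 :> 'I_2 by apply/val_inj.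
by rewrite expr0 expr1; ring.
Qed.

(** Its eigenvalues [a] and [b] satisfy [a + b = x] and [a * b = - y], so that
    [1 - t * x - t ^+ 2 * y = \det (1 - t *: companion x y)] for all [t]. *)
Definition companion (A : comNzRingType) (x y : A) : 'M[A]_2 :=
  \matrix_(i, j) (if i == 0 then if j == 0 then x else y
                   else if j == 0 then 1 else 0).

Section GroupProduct.
Variables (K : fieldType) (A : comNzRingType) (c : {rmorphism K -> A}).
Variables (p : nat) (w : K).
Hypothesis wp : p.-primitive_root w.

Lemma prod_one_sub_root (t : A) : \prod_(k < p) (1 - c (w ^+ k) * t) = 1 - t ^+ p.
Proof.
have := congr1 (horner_morph ((fun x => mulrC t (c x)) : commr_rmorph c t))
  (prod_one_sub_rootX wp).
rewrite rmorph_prod rmorphB rmorph1 rmorphXn /= horner_morphX => <-.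
apply: eq_bigr => k _.
by rewrite rmorphB rmorph1 /= linearZ /= horner_morphX.
Qed.

Lemma prod_one_sub_rootM (M : 'M[A]_2) :
  \prod_(k < p) (1 - c (w ^+ k) *: M) = 1 - M ^+ p.
Proof.
have [cM cME] : exists cM : {rmorphism K -> 'M[A]_2}, forall x, cM x = (c x)%:M.
  by exists (@scalar_mx A 2 \o c).
have h : commr_rmorph cM M.
  by move=> x; rewrite /GRing.comm cME -![_ * _]/(_ *m _) scalar_mxC.
have := congr1 (horner_morph h) (prod_one_sub_rootX wp).
rewrite rmorph_prod rmorphB rmorph1 rmorphXn /= horner_morphX => <-.
apply: eq_bigr => k _.
rewrite rmorphB rmorph1 -mul_polyC rmorphM /= horner_morphX horner_morphC cME.
by rewrite -mul_scalar_mx.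
Qed.

(** By Cayley-Hamilton the traces of powers obey the Lucas recurrence. *)
Lemma trace_companion_lucas (x y : A) n :
  \tr (companion x y ^+ n) = msum (lucas_terms n) x y.
Proof.
set M := companion x y; elim/ltn_ind: n => -[|[|n]] IH.
- by rewrite expr0 mxtrace1 /msum big_cons big_seq1 /monval /= !expr0 mulr1.
- rewrite expr1 /mxtrace !big_ord_recl big_ord0 !mxE /=.
  by rewrite /msum big_seq1 /monval /= expr0 expr1; ring.
- have M2 : M ^+ 2 = x *: M + y%:M.
    apply/matrixP => i j; rewrite expr2 !mxE !big_ord_recl big_ord0 !mxE /=.
    by case: i j => [[|[|//]] ?] [[|[|//]] ?] /=; ring.
  rewrite lucasSS msum_cat msum_shiftx msum_shifty -!IH //.
  rewrite -mxtraceZ -mxtraceZ -mxtraceD; congr (\tr _).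
  have -> : M ^+ n.+2 = M ^+ n * M ^+ 2 by rewrite -exprD addn2.
  rewrite M2 mulrDr -scalerAr -exprSr; congr (_ + _).
  by rewrite -[_ * _]/(_ *m _) mul_mx_scalar.
Qed.

(** With [M = companion x y], the product is the determinant of
    [\prod_k (1 - w ^+ k *: M) = 1 - M ^+ p], that is
    [1 - \tr (M ^+ p) + \det (M ^+ p)], and [\det (M ^+ p) = (- y) ^+ p]. *)
Lemma prod_one_sub_lucas (x y : A) : odd p ->
  \prod_(k < p) (1 - c (w ^+ k) * x - c (w ^+ (2 * k)) * y) =
  1 - msum ((0, p)%N :: lucas_terms p) x y.
Proof.
move=> op.
pose M := companion x y.
have det2 (B : 'M[A]_2) : \det (1 - B) = 1 - \tr B + \det B.
  rewrite !det_mx2 /mxtrace !big_ord_recl big_ord0 !mxE /=.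
  have -> : lift 0 0 = 1 :> 'I_2 by apply/val_inj.
  by rewrite /=; ring.
have detM (r : nat) : \det (M ^+ r) = (- y) ^+ r.
  have detX (s : nat) : \det (M ^+ s) = \det M ^+ s.
    elim: s => [|s IH]; first by rewrite !expr0 det1.
    by rewrite !exprS -IH -[_ * _]/(_ *m _) det_mulmx.
  by rewrite detX det_mx2 !mxE /=; congr (_ ^+ _); ring.
have := congr1 determinant (prod_one_sub_rootM M).
rewrite det2 detM exprNn -signr_odd op expr1 trace_companion_lucas => e.
rewrite -cat1s msum_cat {1}/msum big_seq1 /monval /= expr0 mul1r.
transitivity (1 - msum (lucas_terms p) x y + -1 * y ^+ p); last by ring.
rewrite -e (big_morph determinant (@det_mulmx _ _) (det1 _ _)).
apply: eq_bigr => k _.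
rewrite det2 mxtraceZ detZ det_mx2 /mxtrace !big_ord_recl big_ord0 !mxE /=.
by rewrite mulnC exprM !rmorphXn /=; ring.
Qed.

Lemma prod_one_sub_binom (x y : A) :
  \prod_(k < p) (1 - c (w ^+ k) * x - c (w ^+ k) * y) =
  1 - msum (binom_terms p) x y.
Proof.
rewrite msum_binom -prod_one_sub_root; apply: eq_bigr => k _; ring.
Qed.
End GroupProduct.

(** * A lower bound for N(Gamma) *)

Lemma char_poly_conj (K : fieldType) n (Q D : 'M[K]_n) : Q \in unitmx ->
  char_poly (invmx Q *m D *m Q) = char_poly D.
Proof.
move=> Qu; rewrite /char_poly /char_poly_mx.
have QV : map_mx polyC (invmx Q) *m map_mx polyC Q = 1%:M.
  by rewrite -map_mxM mulVmx // map_mx1.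
have -> : 'X%:M - map_mx polyC (invmx Q *m D *m Q) =
   map_mx polyC (invmx Q) *m ('X%:M - map_mx polyC D) *m map_mx polyC Q.
  rewrite mulmxBr mulmxBl !map_mxM; congr (_ - _).
  by rewrite mul_mx_scalar -scalemxAl QV scalemx1.
rewrite !det_mulmx mulrAC -det_mulmx QV det1 mul1r //.
Qed.

Lemma rank_diag_mx_le (K : fieldType) n (d : 'rV[K]_n) :
  (\rank (diag_mx d) <= count (fun a => a != 0%R) [seq d 0%R i | i <- enum 'I_n])%N.
Proof.
have -> : diag_mx d = \sum_i d 0 i *: delta_mx i i.
  apply/matrixP => i j; rewrite !mxE summxE (bigD1 i) //= !mxE eqxx big1 ?addr0.
    by rewrite andTb eq_sym mulr_natr.
  by move=> k ki; rewrite !mxE eq_sym (negbTE ki) mulr0.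
rewrite count_map -sum1_count [X in (_ <= X)%N]big_mkcond /= big_enum /=.
elim/big_ind2: _ => [|A a B b Aa Bb|i _]; first by rewrite mxrank0.
  by apply: leq_trans (mxrank_add _ _) (leq_add Aa Bb).
case: eqP => [->|_] /=; first by rewrite scale0r mxrank0.
by apply: leq_trans (mxrank_scale _ _) _; rewrite mxrank_delta.
Qed.

Section Spectrum.
Variable R : realType.
Local Notation C := R[i].

(** A hermitian matrix is diagonalizable with real eigenvalues, hence its rank
    is at most the number of its nonzero eigenvalues. *)
Lemma rank_le_signature n (A : 'M[C]_n) : A \is hermsymmx ->
  (\rank A <= count (fun a => 0 < a)%R (eigenvalues A) +
              count (fun a => a < 0)%R (eigenvalues A))%N.
Proof.
move=> Ah; set d := spectral_diag A.
have dreal := hermitian_spectral_diag_real Ah.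
have /orthomx_spectralP AE := hermitian_normalmx Ah.
have Pu := spectral_unit A.
have eigs : perm_eq (eigenvalues A) [seq d 0 i | i <- enum 'I_n].
  apply: prod_XsubC_eq; rewrite big_map big_enum /=.
  rewrite /eigenvalues; case: closed_field_poly_normal => r /= h.
  rewrite (monicP (char_poly_monic A)) scale1r in h.
  rewrite -[LHS]h {1}AE char_poly_conj // char_poly_trig ?diag_mx_is_trig //.
  by apply: eq_bigr => i _; rewrite !mxE eqxx mulr1n.
have /permP eqc := eigs; rewrite !eqc.
rewrite AE; apply: leq_trans (mxrankM_maxl _ _) _.
apply: leq_trans (mxrankM_maxr _ _) _.
apply: leq_trans (rank_diag_mx_le _) _.
rewrite -count_predUI; apply: leq_trans (leq_addr _ _).
rewrite leq_eqVlt; apply/orP; left; apply/eqP; apply: eq_in_count => _ /mapP[i _ ->] /=.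
by rewrite real_neqr_lt ?real0 // 1?orbC //; apply/mxOverP.
Qed.
End Spectrum.

(** For unitary [P] these are the coordinates of [invmx P *m z], as polynomials
    in [z]. *)
Definition adj_form (R : realType) (P : 'M[R[i]]_2) (j : 'I_2) :
    mpoly.mpoly 2 R[i] :=
  \sum_k (P k j)^* *: zvar k.

Local Notation adj_monomial P := (monval (adj_form P 0) (adj_form P 1)).

Section CyclicGroup.
Variable R : realType.
Local Notation C := R[i].
Variables (p : nat) (w : C) (e : 'I_2 -> nat).
Hypothesis wp : p.-primitive_root w.
(* The first weight being 1, distinct powers of [w] give distinct elements. *)
Hypothesis e0 : e 0 = 1%N.

Definition diag_gen : 'M[C]_2 := diag_mx (\row_j w ^+ e j).

Lemma diag_gen_exp k : diag_gen ^+ k = diag_mx (\row_j w ^+ (k * e j)).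
Proof.
elim: k => [|k IH].
  rewrite expr0; apply/matrixP => i j; rewrite !mxE mul0n expr0.
  by case: eqP.
rewrite exprS IH -[_ * _]/(_ *m _) mulmx_diag; congr diag_mx.
by apply/rowP => j; rewrite !mxE -exprD mulSn.
Qed.

Lemma diag_gen_order : diag_gen ^+ p = 1.
Proof.
rewrite diag_gen_exp; apply/matrixP => i j; rewrite !mxE exprM (prim_expr_order wp) expr1n.
by case: eqP.
Qed.

Lemma cyclic_genP (A : 'M[C]_2) :
  cyclic_gen diag_gen A <-> exists2 k, (k < p)%N & A = diag_gen ^+ k.
Proof.
have p0 := prim_order_gt0 wp.
have red (k : nat) : exists2 m, (m < p)%N & diag_gen ^+ k = diag_gen ^+ m.
  by exists (k %% p)%N; rewrite ?ltn_mod // expr_mod ?diag_gen_order.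
split=> [[k _ <-]|[k _ ->]]; last by exists (Posz k).
case: k => k; first exact: red.
have -> : diag_gen ^ (Negz k) = diag_gen ^+ (k.+1 * p.-1).
  have u : diag_gen ^+ k.+1 \is a GRing.unit.
    apply/unitrX; have : diag_gen ^+ p \is a GRing.unit by rewrite diag_gen_order unitr1.
    by rewrite unitrX_pos.
  apply: (mulrI u); rewrite -exprD -mulnS prednK // mulnC exprM diag_gen_order expr1n.
  by rewrite NegzE -exprnN mulrV.
exact: red.
Qed.

Lemma conj_group_perm (G : {fset 'M[C]_2}) (P : 'M[C]_2) : P \in unitmx ->
  [set` G]%classic = [set P *m A *m invmx P | A in cyclic_gen diag_gen]%classic ->
  perm_eq G [seq P *m diag_gen ^+ k *m invmx P | k <- iota 0 p].
Proof.
move=> Pu GE; apply: uniq_perm; first exact: fset_uniq.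
  rewrite map_inj_in_uniq ?iota_uniq // => i j.
  rewrite !mem_iota => ip jp h.
  have {}h : diag_gen ^+ i = diag_gen ^+ j.
    have := congr1 (fun A => invmx P *m A *m P) h.
    rewrite /= -!(mulmxA P) !mulKmx //.
    by rewrite -!mulmxA mulVmx // !mulmx1.
  move: h; rewrite !diag_gen_exp => /matrixP/(_ 0 0).
  rewrite !mxE eqxx !mulr1n e0 !muln1 => /eqP.
  by rewrite (eq_prim_root_expr wp) !modn_small // => /eqP.
move=> A; apply/idP/mapP => [AG|[k]].
  have : [set` G]%classic A by [].
  rewrite GE => -[B /cyclic_genP[k kp ->] <-].
  by exists k; rewrite // mem_iota.
rewrite mem_iota => /= kp ->.
suff : [set` G]%classic (P *m diag_gen ^+ k *m invmx P) by [].
by rewrite GE; exists (diag_gen ^+ k) => //; apply/cyclic_genP; exists k.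
Qed.

Local Notation mp := (mpoly.mpoly 2 C).

Definition zz_scalar : {rmorphism C -> zzbar_poly} :=
  [the {rmorphism C -> zzbar_poly} of @mpoly.mpolyC 2 mp \o @mpoly.mpolyC 2 C].

(** Polynomials in [z], resp. in [conj z], inside the polynomials in both; the
    second embedding conjugates the coefficients, so that
    [zz_hol q * zz_antihol q] is [|q(z)|^2]. *)
Definition zz_hol : {rmorphism mp -> zzbar_poly} :=
  [the {rmorphism mp -> zzbar_poly} of @mpoly.mpolyC 2 mp].

Definition zz_antihol : {rmorphism mp -> zzbar_poly} :=
  [the {rmorphism mp -> zzbar_poly} of
   mpoly.map_mpoly [the {rmorphism C -> mp} of @mpoly.mpolyC 2 C \o Num.conj]].

(** In the coordinates [u] of [invmx P *m z] the group is diagonal, and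
    [<g z, z>] is the combination of the [|u_j|^2] by the eigenvalues of [g]. *)
Lemma act_form_conj P k : P \is unitarymx ->
  act_form (P *m diag_gen ^+ k *m invmx P) =
  \sum_j zz_scalar (w ^+ (k * e j)) * (zz_hol (adj_form P j) * zz_antihol (adj_form P j)).
Proof.
move=> Pu.
rewrite (invmx_unitary Pu).
rewrite (diag_gen_exp k).
rewrite /act_form.
have barE j : zz_antihol (adj_form P j) = \sum_k zz_scalar (P k j) * zbarvar k.
  rewrite rmorph_sum; apply: eq_bigr => l _ /=.
  by rewrite mpoly.map_mpolyZ mpoly.map_mpolyX /= conjCK -mpoly.mul_mpolyC.
have holE j : zz_hol (adj_form P j) = \sum_k zz_scalar ((P k j)^* ) * zz_hol (zvar k).
  rewrite rmorph_sum; apply: eq_bigr => l _.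
  by rewrite -mpoly.mul_mpolyC rmorphM.
under [RHS]eq_bigr => j _ do rewrite barE 2!mulr_sumr.
rewrite [RHS]exchange_big /=; apply: eq_bigr => l _.
rewrite -[mpoly.mpolyC 2 _]/(zz_hol _) [zz_hol _]rmorph_sum big_distrl /=.
under [RHS]eq_bigr => j _ do rewrite holE big_distrl mulr_sumr /=.
rewrite [RHS]exchange_big /=; apply: eq_bigr => m _.
have gE : (P *m diag_mx (\row_j w ^+ (k * e j)) *m map_mx Num.conj P^T) l m =
   \sum_j w ^+ (k * e j) * (P m j)^* * P l j.
  rewrite mul_mx_diag !mxE; apply: eq_bigr => j _; rewrite !mxE; ring.
rewrite gE -mpoly.mul_mpolyC -[mpoly.mpolyC 2 _]/(zz_hol _) rmorphM.
rewrite -[zz_hol (mpoly.mpolyC 2 _)]/(zz_scalar _) rmorph_sum !big_distrl /=.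
apply: eq_bigr => j _; rewrite -!/(zz_scalar _) 2!rmorphM /=; ring.
Qed.

Lemma mcoeff_hol_antihol (I : Type) (F : seq I) (q : I -> mp) m n :
  mpoly.mcoeff m (mpoly.mcoeff n (\sum_(t <- F) zz_hol (q t) * zz_antihol (q t))) =
  \sum_(t <- F) mpoly.mcoeff m (q t) * (mpoly.mcoeff n (q t))^*.
Proof.
elim: F => [|t F IH]; first by rewrite !big_nil !raddf0.
rewrite !big_cons !raddfD -IH /=; congr (_ + _).
rewrite mpoly.mcoeffCM mpoly.mcoeff_map_mpoly /= mulrC mpoly.mcoeffCM.
by rewrite mulrC.
Qed.

(** Substituting [x = |u_1|^2] and [y = |u_2|^2] in the hypothesis gives
    [Phi G = \sum_(t <- F) |u^t|^2]: the coefficient matrix is the Gram matrix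
    of the coefficient vectors of the polynomials [u^t]. *)
Lemma coefmx_gram (G : {fset 'M[C]_2}) (P : 'M[C]_2) (F : seq expo) :
  P \is unitarymx ->
  [set` G]%classic = [set P *m A *m invmx P | A in cyclic_gen diag_gen]%classic ->
  (forall x y : zzbar_poly,
    \prod_(k < p) (1 - zz_scalar (w ^+ (k * e 0)) * x - zz_scalar (w ^+ (k * e 1)) * y) =
    1 - msum F x y) ->
  forall a b, coefmx G a b =
   \sum_(t <- F) mpoly.mcoeff (mpoly.bmnm (enum_val a)) (adj_monomial P t) *
    (mpoly.mcoeff (mpoly.bmnm (enum_val b)) (adj_monomial P t))^*.
Proof.
move=> Pu GE Fid a b.
have PhiE : Phi G = \sum_(t <- F) zz_hol (adj_monomial P t) *
                                   zz_antihol (adj_monomial P t).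
  transitivity (msum F (zz_hol (adj_form P 0) * zz_antihol (adj_form P 0))
                       (zz_hol (adj_form P 1) * zz_antihol (adj_form P 1))); last first.
    by apply: eq_bigr => t _; rewrite monval_mul -!rmorph_monval.
  apply: (subrI 1); rewrite -Fid {1}/Phi opprB addrC subrK.
  rewrite (perm_big _ (conj_group_perm (unitarymx_unit Pu) GE)) big_map.
  rewrite -[p in iota 0 p]subn0 big_mkord; apply: eq_bigr => k _.
  rewrite (act_form_conj k Pu).
  rewrite big_ord_recl big_ord1.
  have -> : lift ord0 ord0 = 1 :> 'I_2 by apply/val_inj.
  by rewrite opprD addrA.
rewrite mxE PhiE.
exact: mcoeff_hol_antihol.
Qed.
End CyclicGroup.

Section RankBound.
Variable R : realType.
Local Notation C := R[i].
Local Notation mp := (mpoly.mpoly 2 C).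

Lemma msize_mul_le (f g : mp) m n : (mpoly.msize f <= m.+1)%N ->
  (mpoly.msize g <= n.+1)%N ->
  (mpoly.msize (f * g) <= (m + n).+1)%N.
Proof.
have [->|f0] := eqVneq f 0; first by rewrite mul0r mpoly.msize0.
have [->|g0] := eqVneq g 0; first by rewrite mulr0 mpoly.msize0.
move=> fm gn; rewrite mpoly.msizeM // -subn1 leq_subLR add1n -addnS -addSn.
exact: leq_add.
Qed.

Lemma msize_exp_le (f : mp) n : (mpoly.msize f <= 2)%N ->
  (mpoly.msize (f ^+ n) <= n.+1)%N.
Proof.
move=> f2; elim: n => [|n IH]; first by rewrite expr0 mpoly.msize1.
by rewrite exprS (msize_mul_le (m := 1) f2 IH).
Qed.

Lemma msize_adj_form (P : 'M[C]_2) j : (mpoly.msize (adj_form P j) <= 2)%N.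
Proof.
rewrite /adj_form; apply: leq_trans (mpoly.msize_sum _ _ _) _.
apply/bigmax_leqP_seq => k _ _; apply: leq_trans (mpoly.msizeZ_le _ _) _.
by rewrite mpoly.msizeX mpoly.mdeg1.
Qed.

Lemma msize_monval_adj_form (P : 'M[C]_2) a d : (a.1 + a.2 <= d)%N ->
  (mpoly.msize (adj_monomial P a)%R <= d.+1)%N.
Proof.
move=> ad; apply: leq_trans (_ : (a.1 + a.2).+1 <= _)%N; last by [].
by apply: msize_mul_le; apply: msize_exp_le; apply: msize_adj_form.
Qed.

(** Encodes a monomial in two variables as one power of a single variable;
    injective as long as the first exponent stays below [M]. *)
Definition kronecker_exp (M : nat) (a : expo) : nat := (a.1 + M * a.2)%N.

Lemma kronecker_exp_inj M : {in [pred a | (a.1 < M)%N] &, injective (kronecker_exp M)}.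
Proof.
move=> [a b] [a' b']; rewrite !inE /kronecker_exp /= => aM aM' h.
have e : a = a'.
  have := congr1 (modn^~ M) h.
  by rewrite /= ![(_ + M * _)%N]addnC ![(M * _)%N]mulnC !modnMDl !modn_small.
have M0 : (0 < M)%N by apply: leq_ltn_trans aM.
by move: h; rewrite e => /addnI/eqP; rewrite eqn_pmul2l // => /eqP ->.
Qed.

(** The point [P *m (X, X^M)], chosen to make [adj_form P] evaluate to [X] and
    [X^M]. *)
Definition kronecker_point (P : 'M[C]_2) (M : nat) (j : 'I_2) : {poly C} :=
  P j 0 *: 'X + P j 1 *: 'X^M.

Lemma mmap_adj_form (P : 'M[C]_2) M j : P \is unitarymx ->
  mpoly.mmap polyC (kronecker_point P M) (adj_form P j) = if j == 0 then 'X else 'X^M.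
Proof.
move=> Pu; rewrite rmorph_sum /=.
have PP i : \sum_k (P k j)^* * P k i = (i == j)%:R.
  have /matrixP/(_ j i) := mulVmx (unitarymx_unit Pu).
  rewrite invmx_unitary // !mxE eq_sym => <-; apply: eq_bigr => k _; by rewrite !mxE.
under eq_bigr => k _ do
  rewrite mpoly.mmapZ mpoly.mmapX mpoly.mmap1U /kronecker_point mulrDr !mul_polyC !scalerA.
rewrite big_split /= -!scaler_suml !PP.
case: j PP => [[|[|//]] jlt] _; rewrite -!val_eqE /=.
  by rewrite scale1r scale0r addr0.
by rewrite scale1r scale0r add0r.
Qed.

(** The matrix [X] extracts, from the coefficients of a polynomial, those of
    its value at [kronecker_point P M].  There the polynomials [u^t] become
    powers of a single variable, distinct for distinct [t], so compressing the
    Gram matrix by [X] gives an invertible diagonal matrix whose entries are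
    the multiplicities in [F]. *)
Lemma rank_gram_ge (n : nat) (G : {fset 'M[C]_2}) (P : 'M[C]_2) (F s : seq expo) :
  P \is unitarymx -> #|` G| = n ->
  (forall a b, coefmx G a b =
   \sum_(t <- F) mpoly.mcoeff (mpoly.bmnm (enum_val a)) (adj_monomial P t) *
    (mpoly.mcoeff (mpoly.bmnm (enum_val b)) (adj_monomial P t))^*) ->
  (forall a, a \in F -> (a.1 + a.2 <= n)%N) ->
  uniq s -> {subset s <= F} -> (size s <= \rank (coefmx G))%N.
Proof.
move=> Pu Gn gram degF us sF.
pose M := n.+1.
pose v a (x : midx G) := mpoly.mcoeff (mpoly.bmnm x) (adj_monomial P a).
pose X : 'M[C]_(size s, #|midx G|) := \matrix_(i, a)
  (mpoly.mmap1 (kronecker_point P M) (mpoly.bmnm (enum_val a)))`_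
    (kronecker_exp M (nth (0, 0)%N s i)).
have sM a : a \in F -> a \in [pred a : expo | (a.1 < M)%N].
  by move=> /degF h; rewrite inE ltnS (leq_trans _ h) // leq_addr.
have Xv t (i : 'I_(size s)) : t \in F ->
    \sum_a X i a * v t (enum_val a) = (nth (0, 0)%N s i == t)%:R.
  move=> tF.
  transitivity ('X^(kronecker_exp M t) : {poly C})`_(kronecker_exp M (nth (0, 0)%N s i)).
    have -> : 'X^(kronecker_exp M t) =
        mpoly.mmap polyC (kronecker_point P M) (adj_monomial P t).
      rewrite rmorph_monval /= (mmap_adj_form M 0 Pu) (mmap_adj_form M 1 Pu).
      by rewrite /monval -exprM -exprD.
    rewrite (mpoly.mmapE _ (msize_monval_adj_form P (degF _ tF))) coef_sum.
    pose f (x : midx G) := (mpoly.mmap1 (kronecker_point P M) (mpoly.bmnm x))`_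
      (kronecker_exp M (nth (0, 0)%N s i)) * v t x.
    transitivity (\sum_(x in midx G) f x).
      by rewrite [RHS]big_enum_val; apply: eq_bigr => a _; rewrite mxE.
    rewrite -Gn; apply: eq_bigr => x _.
    by rewrite coefCM mulrC.
  rewrite coefXn (inj_in_eq (@kronecker_exp_inj M)) // sM // sF // mem_nth //.
have key : X *m coefmx G *m (map_mx Num.conj X)^T =
    diag_mx (\row_(i < size s) (count_mem (nth (0, 0)%N s i) F)%:R).
  apply/matrixP => i k; rewrite !mxE.
  transitivity (\sum_(t <- F) (\sum_a X i a * v t (enum_val a)) *
       (\sum_b X k b * v t (enum_val b))^*).
    under eq_bigr => b _.
      rewrite mxE big_distrl /=.
      under eq_bigr => a _ do rewrite gram mulr_sumr big_distrl /=.
      over.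
    rewrite /= exchange_big /=.
    under eq_bigr => a _ do rewrite exchange_big /=.
    rewrite exchange_big /=; apply: eq_bigr => t _.
    rewrite mulr_suml; apply: eq_bigr => a _.
    rewrite rmorph_sum mulr_sumr; apply: eq_bigr => b _.
    by rewrite !mxE rmorphM /=; ring.
  have [ik|ik] := eqVneq i k.
    rewrite -ik mulr1n -sum1_count [in RHS]big_mkcond natr_sum; apply: eq_big_seq => t tF.
    rewrite !Xv //= [t == _]eq_sym; case: (_ == t); by rewrite ?conjC1 ?mulr1 ?mul0r.
  rewrite mulr0n big1_seq // => t /andP[_ tF]; rewrite !Xv //.
  case: eqP => [<-|_]; last by rewrite mul0r.
  by rewrite nth_uniq // eq_sym (inj_eq val_inj) (negbTE ik) conjC0 mulr0.
have : \rank (X *m coefmx G *m (map_mx Num.conj X)^T) = size s.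
  rewrite key mxrank_unit // unitmxE det_diag unitfE.
  apply/prodf_neq0 => i _; rewrite mxE pnatr_eq0 -lt0n -has_count has_pred1.
  by rewrite sF // mem_nth.
by move=> <-; apply: leq_trans (mxrankM_maxl _ _) (mxrankM_maxr _ _).
Qed.

Lemma coefmx_herm (G : {fset 'M[C]_2}) (I : eqType) (F : seq I) (q : I -> mp) :
  (forall a b, coefmx G a b =
   \sum_(t <- F) mpoly.mcoeff (mpoly.bmnm (enum_val a)) (q t) *
    (mpoly.mcoeff (mpoly.bmnm (enum_val b)) (q t))^*) ->
  coefmx G \is hermsymmx.
Proof.
move=> gram; apply/is_hermitianmxP; rewrite expr0 scale1r.
apply/matrixP => a b; rewrite gram 2!mxE gram rmorph_sum; apply: eq_bigr => t _.
by rewrite rmorphM /= conjCK mulrC.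
Qed.
End RankBound.

Section SignatureBound.
Variable R : realType.
Local Notation C := R[i].
Variables (p : nat) (w : C) (e : 'I_2 -> nat).
Hypothesis wp : p.-primitive_root w.
Hypothesis e0 : e 0 = 1%N.

Lemma NGamma_ge (G : {fset 'M[C]_2}) (P : 'M[C]_2) (F s : seq expo) :
  P \is unitarymx ->
  [set` G]%classic = [set P *m A *m invmx P | A in cyclic_gen (diag_gen w e)]%classic ->
  (forall x y : zzbar_poly,
    \prod_(k < p) (1 - zz_scalar R (w ^+ (k * e 0)) * x -
                       zz_scalar R (w ^+ (k * e 1)) * y) =
    1 - msum F x y) ->
  (forall a, a \in F -> (a.1 + a.2 <= p)%N) ->
  uniq s -> {subset s <= F} -> (size s <= NGamma G)%N.
Proof.
move=> Pu GE Fid Fdeg us sF.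
have gram := coefmx_gram wp e0 Pu GE Fid.
have Gp : #|` G| = p.
  by rewrite (perm_size (conj_group_perm wp e0 (unitarymx_unit Pu) GE)) size_map size_iota.
apply: leq_trans (rank_gram_ge Pu Gp gram Fdeg us sF) _.
exact: rank_le_signature (coefmx_herm gram).
Qed.
End SignatureBound.

(** * Holomorphic polynomials restrict to smooth CR functions *)

Section RealPoly.
Context {R : realType} {n : nat}.
Local Notation V := ('cV[R]_n * 'cV[R]_n)%type.

(** Polynomial functions of the real coordinates, generated inductively so
    that stability under directional derivatives, and hence smoothness, is an
    easy induction. *)
Inductive real_poly : (V -> R) -> Prop :=
| real_poly_cst c : real_poly (fun=> c)
| real_poly_re j : real_poly (fun p => p.1 j 0)
| real_poly_im j : real_poly (fun p => p.2 j 0)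
| real_polyD f g : real_poly f -> real_poly g -> real_poly (fun p => f p + g p)
| real_polyM f g : real_poly f -> real_poly g -> real_poly (fun p => f p * g p).

Lemma real_poly_continuous f : real_poly f -> continuous f.
Proof.
elim=> [c|j|j|{}f g _ cf _ cg|{}f g _ cf _ cg] p.
- exact: cvg_cst.
- apply: (@continuous_comp _ _ _ fst (fun x : 'cV[R]_n => x j 0)); first exact: cvg_fst.
  exact: coord_continuous.
- apply: (@continuous_comp _ _ _ snd (fun x : 'cV[R]_n => x j 0)); first exact: cvg_snd.
  exact: coord_continuous.
- exact: (continuousD (cf p) (cg p)).
- exact: (continuousM (cf p) (cg p)).
Qed.

Lemma is_derive_linear_form (f : V -> R) p v :
  (forall h q, f (h *: v + q) = h * f v + f q) -> is_derive p v f (f v).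
Proof.
move=> flin.
have h : (fun h : R => h^-1 *: ((f \o shift p) (h *: v) - f p)) @ 0^' --> f v.
  apply: cvg_near_cst; near=> h.
  rewrite /= flin addrK scalerA mulVf ?scale1r //.
  by near: h; exact: nbhs_dnbhs_neq.
by apply: DeriveDef; [apply/cvg_ex; exists (f v) | apply: cvg_lim].
Unshelve. all: by end_near.
Qed.

Lemma real_poly_is_derive f v : real_poly f ->
  exists2 g, real_poly g & forall p, is_derive p v f (g p).
Proof.
elim=> [c|j|j|{}f g pf [f' pf' df] pg [g' pg' dg]|{}f g pf [f' pf' df] pg [g' pg' dg]].
- by exists (fun=> 0); [apply: real_poly_cst | move=> p; apply: is_derive_cst].
- exists (fun=> v.1 j 0); first exact: real_poly_cst.
  by move=> p; apply: is_derive_linear_form => h q /=; rewrite !mxE.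
- exists (fun=> v.2 j 0); first exact: real_poly_cst.
  by move=> p; apply: is_derive_linear_form => h q /=; rewrite !mxE.
- exists (fun p => f' p + g' p); first exact: real_polyD.
  by move=> p; apply: is_deriveD.
- exists (fun p => f p * g' p + g p * f' p);
    first by apply: real_polyD; apply: real_polyM.
  by move=> p; apply: is_deriveM.
Qed.

Lemma real_poly_smooth f : real_poly f -> smooth_on setT f.
Proof.
move=> pf k; elim: k f pf => [|k IH] f pf /=; split=> //.
- by move=> p _; apply: real_poly_continuous.
- by move=> p _; apply: real_poly_continuous.
move=> v; have [g pg dg] := real_poly_is_derive v pf; split.
  by move=> p _; have [] := dg p.
have -> : (fun p => 'D_v f p) = g by apply/funext => p; apply: derive_val.
exact: IH.
Qed.

Lemma real_poly_derivable f p v : real_poly f -> derivable f p v.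
Proof. by move=> /(real_poly_is_derive v)[g _ /(_ p)[]]. Qed.
End RealPoly.

(** With [h = 1/2] and [i] the imaginary unit, [h * (a + i * c)] has the shape
    of [dbar]; these identities are behind its additivity and Leibniz rule. *)
Lemma dbar_additivity (A : comNzRingType) (h i a b c d : A) :
  h * (a + b + i * (c + d)) = h * (a + i * c) + h * (b + i * d).
Proof. ring. Qed.

Lemma dbar_leibniz (A : comNzRingType) (h i f g a b c d : A) :
  h * (f * a + g * b + i * (f * c + g * d)) = f * (h * (a + i * c)) + g * (h * (b + i * d)).
Proof. ring. Qed.

Lemma re_leibniz (A : comNzRingType) (a b c d a' b' c' d' : A) :
  a * c' + c * a' - (b * d' + d * b') = a * c' - b * d' + (c * a' - d * b').
Proof. ring. Qed.

Lemma im_leibniz (A : comNzRingType) (a b c d a' b' c' d' : A) :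
  a * d' + d * a' + (b * c' + c * b') = a * d' + b * c' + (c * b' + d * a').
Proof. ring. Qed.

Section Holomorphic.
Context {R : realType} {n : nat}.
Local Notation C := R[i].
Local Notation V := ('cV[R]_n * 'cV[R]_n)%type.

(** The Cauchy-Riemann equations hold on the whole space, and not only along
    the sphere. *)
Definition holo_poly (F : V -> C) : Prop :=
  [/\ real_poly (fun p => complex.Re (F p)), real_poly (fun p => complex.Im (F p))
    & forall j p, dbar j F p = 0].

Lemma holo_poly_cst c : holo_poly (fun=> c).
Proof.
split; try exact: real_poly_cst.
move=> j p; rewrite /dbar /Cderive !derive_cst; apply/eqP; rewrite eq_complex /=.
by apply/andP; split; apply/eqP; ring.
Qed.

Lemma holo_polyD F G : holo_poly F -> holo_poly G -> holo_poly (fun p => F p + G p).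
Proof.
move=> [rF iF dF] [rG iG dG].
have reE : (fun p => complex.Re (F p + G p)) =
    (fun p => complex.Re (F p)) + (fun p => complex.Re (G p)).
  by apply/funext => p; rewrite !fctE /=; case: (F p) => a b; case: (G p) => c d.
have imE : (fun p => complex.Im (F p + G p)) =
    (fun p => complex.Im (F p)) + (fun p => complex.Im (G p)).
  by apply/funext => p; rewrite !fctE /=; case: (F p) => a b; case: (G p) => c d.
split.
- by rewrite reE; apply: real_polyD.
- by rewrite imE; apply: real_polyD.
move=> j p; transitivity (dbar j F p + dbar j G p); last by rewrite dF dG addr0.
have DE v : Cderive v (fun p => F p + G p) p = Cderive v F p + Cderive v G p.
  by rewrite /Cderive reE imE !deriveD //; apply: real_poly_derivable.
by rewrite /dbar !DE dbar_additivity.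
Qed.

Lemma holo_polyM F G : holo_poly F -> holo_poly G -> holo_poly (fun p => F p * G p).
Proof.
move=> [rF iF dF] [rG iG dG].
have reE : (fun p => complex.Re (F p * G p)) =
   (fun p => complex.Re (F p)) * (fun p => complex.Re (G p)) -
   (fun p => complex.Im (F p)) * (fun p => complex.Im (G p)).
  by apply/funext => p; rewrite !fctE /=; case: (F p) => a b; case: (G p) => c d.
have imE : (fun p => complex.Im (F p * G p)) =
   (fun p => complex.Re (F p)) * (fun p => complex.Im (G p)) +
   (fun p => complex.Im (F p)) * (fun p => complex.Re (G p)).
  by apply/funext => p; rewrite !fctE /=; case: (F p) => a b; case: (G p) => c d.
split.
- have -> : (fun p => complex.Re (F p * G p)) = (fun p =>
    complex.Re (F p) * complex.Re (G p) + -1 * (complex.Im (F p) * complex.Im (G p))).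
    by rewrite reE; apply/funext => p; rewrite /= mulN1r.
  by apply: real_polyD; apply: real_polyM => //; [apply: real_poly_cst|apply: real_polyM].
- by rewrite imE; apply: real_polyD; apply: real_polyM.
move=> j p; transitivity (F p * dbar j G p + G p * dbar j F p);
  last by rewrite dF dG !mulr0 addr0.
have dv f v : real_poly f -> derivable f p v by apply: real_poly_derivable.
have DE v : Cderive v (fun p => F p * G p) p = F p * Cderive v G p + G p * Cderive v F p.
  rewrite /Cderive reE imE deriveB ?deriveD ?deriveM; try (by apply: dv);
    try (by apply: derivableM; apply: dv).
  case: (F p) => a b; case: (G p) => c d; rewrite /GRing.scale /=.
  by apply/eqP; rewrite eq_complex /=; apply/andP; split; apply/eqP;
    [exact: re_leibniz | exact: im_leibniz].
by rewrite /dbar !DE dbar_leibniz.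
Qed.

Lemma holo_poly_coord j : holo_poly (fun p => cplx p j 0).
Proof.
have reE : (fun p : V => complex.Re (cplx p j 0)) = fun p => p.1 j 0.
  by apply/funext => p; rewrite mxE.
have imE : (fun p : V => complex.Im (cplx p j 0)) = fun p => p.2 j 0.
  by apply/funext => p; rewrite mxE.
split.
- by rewrite reE; apply: real_poly_re.
- by rewrite imE; apply: real_poly_im.
move=> i p; rewrite /dbar /Cderive reE imE.
have d1 v : 'D_v (fun p : V => p.1 j 0) p = v.1 j 0.
  by have [] := @is_derive_linear_form R n (fun p : V => p.1 j 0) p v
     (fun h q => ltac:(by rewrite /= !mxE)).
have d2 v : 'D_v (fun p : V => p.2 j 0) p = v.2 j 0.
  by have [] := @is_derive_linear_form R n (fun p : V => p.2 j 0) p v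
     (fun h q => ltac:(by rewrite /= !mxE)).
rewrite !d1 !d2 /= !mxE.
by apply/eqP; rewrite eq_complex /=; apply/andP; split; apply/eqP; ring.
Qed.

Lemma holo_polyX F k : holo_poly F -> holo_poly (fun p => F p ^+ k).
Proof.
move=> hF; elim: k => [|k IH]; first exact: holo_poly_cst.
have -> : (fun p => F p ^+ k.+1) = (fun p => F p * F p ^+ k).
  by apply/funext => p; rewrite exprS.
exact: holo_polyM.
Qed.

Lemma holo_poly_sum (I : Type) (r : seq I) (F : I -> V -> C) :
  (forall i, holo_poly (F i)) -> holo_poly (fun p => \sum_(i <- r) F i p).
Proof.
move=> hF; elim: r => [|i r IH].
  have -> : (fun p => \sum_(i <- [::]) F i p) = fun=> 0.
    by apply/funext => p; rewrite big_nil.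
  exact: holo_poly_cst.
have -> : (fun p => \sum_(i <- i :: r) F i p) = fun p => F i p + \sum_(i <- r) F i p.
  by apply/funext => p; rewrite big_cons.
exact: holo_polyD.
Qed.

Lemma smooth_CR_holo_poly (g : 'cV[C]_n -> C) :
  holo_poly (fun p => g (cplx p)) -> smooth_CR_function g.
Proof.
move=> [rg ig dg] p _; exists setT, (fun p => g (cplx p)); split=> //.
- exact: openT.
- by split; apply: real_poly_smooth.
- by move=> q _ _ a _; rewrite big1 // => j _; rewrite dg mulr0.
Qed.
End Holomorphic.

(** * Monomial sphere maps *)

Section MonomialMap.
Context {R : realType}.
Local Notation C := R[i].

Definition sqnorm (z : C) : R := complex.Re z ^+ 2 + complex.Im z ^+ 2.

Lemma mul_conjE (z : C) : z * z^* = (sqnorm z)%:C%C.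
Proof.
case: z => a b; apply/eqP; rewrite eq_complex /sqnorm /=.
apply/andP; split; apply/eqP; first by rewrite mulrN opprK !expr2.
by rewrite mulrN mulrC addNr.
Qed.

Lemma hdot_unitary n (P : 'M[C]_n) z : P \is unitarymx -> hdot (P *m z) (P *m z) = hdot z z.
Proof.
move=> Pu; have hE m (v : 'cV[C]_m) : hdot v v = ((map_mx Num.conj v)^T *m v) 0 0.
  by rewrite mxE; apply: eq_bigr => j _; rewrite !mxE mulrC.
rewrite !hE map_mxM trmx_mul mulmxA -(mulmxA _ _ P).
have -> : (map_mx Num.conj P)^T *m P = 1%:M.
  by rewrite map_trmx -(invmx_unitary Pu) mulVmx // unitarymx_unit.
by rewrite mulmx1.
Qed.

Lemma sphere_unitary n (P : 'M[C]_n) z : P \is unitarymx -> sphere z -> sphere (P *m z).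
Proof. by move=> Pu; rewrite /sphere /= hdot_unitary. Qed.

Lemma unitary_invmx n (P : 'M[C]_n) : P \is unitarymx -> invmx P \is unitarymx.
Proof. by move=> Pu; rewrite (invmx_unitary Pu) trmxC_unitary. Qed.

(** Two constant functions are linearly dependent. *)
Lemma nonconstant_minimal n N (f : 'cV[C]_n -> 'cV[C]_N) :
  (exists z : 'cV[C]_n, sphere z) -> (1 < N)%N -> minimal_embedding f ->
  nonconstant_on_sphere f.
Proof.
case: N f => [|[|N]] // f [z0 sz0] _ fmin; apply: contrapT => fcst.
have fE z : sphere z -> f z = f z0.
  by move=> sz; apply: contrapT => nz; apply: fcst; exists z, z0.
have lin (c : 'cV[C]_N.+2) : \sum_i c i 0 * f z0 i 0 = 0 -> c = 0.
  by move=> c0; apply: fmin => z /fE ->.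
have sumd (i : 'I_N.+2) : \sum_j (delta_mx i 0 : 'cV[C]_N.+2) j 0 * f z0 j 0 = f z0 i 0.
  rewrite (bigD1 i) //= big1 ?addr0 ?mxE ?eqxx ?mul1r // => j ji.
  by rewrite mxE (negbTE ji) mul0r.
have delta0 (i : 'I_N.+2) : f z0 i 0 <> 0.
  move=> fi; have /lin/matrixP/(_ i 0) := etrans (sumd i) fi.
  by rewrite !mxE !eqxx => /eqP; rewrite oner_eq0.
pose c : 'cV[C]_N.+2 := f z0 1 0 *: delta_mx 0 0 - f z0 0 0 *: delta_mx 1 0.
suff /lin/matrixP/(_ 0 0) : \sum_i c i 0 * f z0 i 0 = 0.
  by rewrite !mxE eqxx /= !mulr1 mulr0 subr0 => /delta0.
transitivity (f z0 1 0 * f z0 0 0 - f z0 0 0 * f z0 1 0); last by rewrite mulrC subrr.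
rewrite -[in X in X - _](sumd 0) -[in X in _ - X](sumd 1) !mulr_sumr -sumrB.
by apply: eq_bigr => j _; rewrite /c !mxE mulrBl !mulrA.
Qed.

(** Cayley transform: infinitely many complex numbers of modulus 1. *)
Definition unit_point (n : nat) : C :=
  (1 +i* n%:R)%C / (1 -i* n%:R)%C.

Lemma unit_point_den (n : nat) : (1 -i* n%:R)%C != 0 :> C.
Proof. by rewrite eq_complex /= oner_eq0. Qed.

Lemma unit_point_norm n : unit_point n * (unit_point n)^* = 1.
Proof.
have c1 : ((1 -i* n%:R)%C : C)^* = (1 +i* n%:R)%C.
  by apply/eqP; rewrite eq_complex /= opprK !eqxx.
have c2 : ((1 +i* n%:R)%C : C)^* = (1 -i* n%:R)%C by [].
rewrite /unit_point rmorphM fmorphV /= c1 c2 mulrACA -invfM.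
rewrite [X in _ / X]mulrC mulfV // mulf_neq0 ?unit_point_den //.
by rewrite eq_complex /= oner_eq0.
Qed.

Lemma unit_point_inj : injective unit_point.
Proof.
move=> m n /eqP; rewrite /unit_point eqr_div ?unit_point_den //.
move=> /eqP/(congr1 (@complex.Im R)) /=.
rewrite !mul1r !mulr1 => h.
have : (m%:R : R) = n%:R by lra.
by move/eqP; rewrite eqr_nat => /eqP.
Qed.

Variables (P : 'M[C]_2) (c : expo -> R) (s : seq expo).
Hypothesis Pu : P \is unitarymx.

(** The square roots of the weights make [|monomial_map z|^2] equal to
    [\sum_(a <- s) c a * |u_1|^(2 a_1) * |u_2|^(2 a_2)] with
    [u = invmx P *m z]. *)
Definition monomial_map (z : 'cV[C]_2) : 'cV[C]_(size s) :=
  \col_i ((Num.sqrt (c (nth (0, 0)%N s i)))%:C%C *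
    monval ((invmx P *m z) 0 0) ((invmx P *m z) 1 0) (nth (0, 0)%N s i)).

Lemma hdot2E (z : 'cV[C]_2) :
  hdot z z = (sqnorm (z 0 0) + sqnorm (z 1 0))%:C%C.
Proof.
rewrite /hdot big_ord_recl big_ord1.
have -> : lift ord0 ord0 = 1 :> 'I_2 by apply/val_inj.
by rewrite [RHS]rmorphD !mul_conjE.
Qed.

Lemma monval_mul_conj (u v : C) a :
  monval u v a * (monval u v a)^* = (monval (sqnorm u) (sqnorm v) a)%:C%C.
Proof.
by rewrite (rmorph_monval Num.conj) -monval_mul !mul_conjE (rmorph_monval (real_complex R)).
Qed.

Hypothesis c0 : {in s, forall a, 0 < c a}.

Lemma monomial_map_sphere z :
  (forall x y, x + y = 1 -> \sum_(a <- s) c a * monval x y a = 1) ->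
  sphere z -> sphere (monomial_map z).
Proof.
move=> c1 /(sphere_unitary (unitary_invmx Pu)).
rewrite /sphere /= hdot2E /hdot; set u := invmx P *m z.
move=> h; have /c1 {}h : sqnorm (u 0 0) + sqnorm (u 1 0) = 1.
  by apply: (fmorph_inj (real_complex R)); rewrite rmorph1.
rewrite -(rmorph1 (real_complex R)) -h rmorph_sum (big_nth (0, 0)%N) big_mkord /=.
apply: eq_bigr => i _.
rewrite mxE -/u [(_ * _)^*]rmorphM mulrACA monval_mul_conj mul_conjE.
rewrite [RHS]rmorphM; congr (_%:C%C * _).
by rewrite /sqnorm /= expr0n addr0 sqr_sqrtr // ltW // c0 // mem_nth.
Qed.

Lemma monomial_map_CR i : smooth_CR_function (fun z => monomial_map z i 0).
Proof.
apply: smooth_CR_holo_poly.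
have hu j : holo_poly (fun p => (invmx P *m cplx p) j 0).
  have -> : (fun p => (invmx P *m cplx p) j 0) = fun p => \sum_k invmx P j k * cplx p k 0.
    by apply/funext => p; rewrite mxE.
  by apply: holo_poly_sum => k; apply: holo_polyM;
    [apply: holo_poly_cst|apply: holo_poly_coord].
have -> : (fun p => monomial_map (cplx p) i 0) = fun p =>
   (Num.sqrt (c (nth (0, 0)%N s i)))%:C%C *
    (((invmx P *m cplx p) 0 0) ^+ (nth (0, 0)%N s i).1 *
     ((invmx P *m cplx p) 1 0) ^+ (nth (0, 0)%N s i).2).
  by apply/funext => p; rewrite mxE.
apply: holo_polyM; first exact: holo_poly_cst.
by apply: holo_polyM; apply: holo_polyX.
Qed.

Hypothesis us : uniq s.

(** Along the curve [u = (r t, r t^M)], [|t| = 1], [r^2 = 1/2], of the sphere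
    distinct monomials become distinct powers of [t].  A linear relation thus
    yields a polynomial in [t] vanishing at infinitely many points. *)
Lemma monomial_map_minimal : minimal_embedding monomial_map.
Proof.
move=> d d0; pose M := (\max_(a <- s) a.1).+1.
pose r : C := (Num.sqrt (2^-1 : R))%:C%C.
have r2 : r * r^* = 2^-1.
  rewrite mul_conjE /sqnorm /= expr0n addr0 sqr_sqrtr ?invr_ge0 ?ler0n //.
  by rewrite fmorphV rmorph_nat.
have r0 : r != 0.
  by apply/eqP => r0; move/eqP: r2; rewrite r0 mul0r eq_sym invr_eq0 pnatr_eq0.
pose K (i : 'I_(size s)) := d i 0 * (Num.sqrt (c (nth (0, 0)%N s i)))%:C%C *
   monval r r (nth (0, 0)%N s i).
pose Q : {poly C} := \sum_i K i *: 'X^(kronecker_exp M (nth (0, 0)%N s i)).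
have Qroot n : root Q (unit_point n).
  set t := unit_point n.
  pose w : 'cV[C]_2 := \col_j (r * t ^+ (if j == 0 then 1 else M)).
  have sw : sphere w.
    have tk k : (r * t ^+ k) * (r * t ^+ k)^* = 2^-1.
      by rewrite rmorphM rmorphXn mulrACA r2 -exprMn unit_point_norm expr1n mulr1.
    rewrite /sphere /= /hdot big_ord_recl big_ord1 !mxE !tk.
    by rewrite [RHS]splitr mul1r.
  apply/eqP; rewrite horner_sum -[RHS](d0 (P *m w) (sphere_unitary Pu sw)).
  apply: eq_bigr => i _; rewrite hornerZ hornerXn mxE mulmxA mulVmx ?unitarymx_unit //.
  rewrite mul1mx !mxE /= expr1 /K -!mulrA monval_mul; congr (_ * (_ * _)).
  by rewrite {1}/monval -[RHS]mulrA; congr (_ * (_ * _)); rewrite /monval -exprM -exprD.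
have Q0 : Q = 0.
  apply: (@roots_geq_poly_eq0 _ _ [seq unit_point n | n <- iota 0 (size Q)]).
  - by apply/allP => _ /mapP[n _ ->].
  - by rewrite map_inj_uniq ?iota_uniq //; apply: unit_point_inj.
  - by rewrite size_map size_iota.
have sM a : a \in s -> a \in [pred a : expo | (a.1 < M)%N].
  by move=> sa; rewrite inE ltnS (big_rem a) //= leq_maxl.
apply/colP => i; rewrite mxE.
have : Q`_(kronecker_exp M (nth (0, 0)%N s i)) = 0 by rewrite Q0 coef0.
rewrite coef_sum (bigD1 i) //= coefZ coefXn eqxx mulr1 big1 ?addr0.
  move/eqP; rewrite !mulf_eq0 !expf_eq0 (negbTE r0) !andbF !orbF.
  move=> /orP[/eqP //|].
  rewrite eq_complex /= eqxx andbT gt_eqF //.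
  by rewrite sqrtr_gt0 c0 // mem_nth.
move=> j ji; rewrite coefZ coefXn (inj_in_eq (@kronecker_exp_inj M)) ?sM ?mem_nth //.
by rewrite nth_uniq // eq_sym (inj_eq val_inj) (negbTE ji) mulr0.
Qed.

(** The power [k] of the generator multiplies the monomial [u^a] by
    [w ^+ (k * (e_0 a_1 + e_1 a_2))]. *)
Lemma monomial_map_invariant (p : nat) (w : C) (e : 'I_2 -> nat) g z :
  w ^+ p = 1 -> all (fun a => p %| e 0%R * a.1 + e 1%R * a.2)%N s ->
  (exists k, g = P *m diag_gen w e ^+ k *m invmx P) ->
  monomial_map (g *m z) = monomial_map z.
Proof.
move=> wp se [k ->]; apply/colP => i; rewrite mxE [RHS]mxE; congr (_ * _).
have gE j : (invmx P *m (P *m diag_gen w e ^+ k *m invmx P *m z)) j 0 =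
  w ^+ (k * e j) * (invmx P *m z) j 0.
  by rewrite -!mulmxA mulKmx ?unitarymx_unit // diag_gen_exp mul_diag_mx !mxE.
rewrite !gE monval_mul -[RHS]mul1r; congr (_ * _).
rewrite /monval -!exprM -exprD -!mulnA -mulnDr mulnC.
have /dvdnP[m ->] : (p %| e 0%R * (nth (0, 0)%N s i).1 + e 1%R * (nth (0, 0)%N s i).2)%N.
  by apply: (allP se); rewrite mem_nth.
by rewrite mulnAC mulnC exprM wp expr1n.
Qed.

End MonomialMap.

(** * Invariant sphere maps of every large dimension *)

Lemma sphere2_inhabited (R : realType) : exists z : 'cV[R[i]]_2, sphere z.
Proof.
exists (delta_mx 0 0); rewrite /sphere /= hdot2E !mxE /sqnorm /=.
by rewrite expr1n !expr0n !addr0.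
Qed.

(** The exponents of [F] enter twice: they bound N(Gamma) from below, and they
    are the building blocks of the invariant families of the required sizes. *)
Lemma exists_invariant_map (R : realType) (G : {fset 'M[R[i]]_2}) (P : 'M[R[i]]_2)
    (p : nat) (w : R[i]) (e : 'I_2 -> nat) (F t : seq expo) (N : nat) :
  P \is unitarymx -> p.-primitive_root w -> e 0 = 1%N ->
  [set` G] = [set P *m A *m invmx P | A in cyclic_gen (diag_gen w e)] ->
  (forall x y : zzbar_poly,
    \prod_(k < p) (1 - zz_scalar R (w ^+ (k * e 0)) * x -
                       zz_scalar R (w ^+ (k * e 1)) * y) =
    1 - msum F x y) ->
  (forall a, a \in F -> (a.1 + a.2 <= p)%N) ->
  uniq t -> t =i F -> (1 < size t)%N ->
  (forall M, (2 * size t - 1 <= M)%N -> exists s : seq expo, [/\ uniq s, unital R s,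
    all (fun a => p %| e 0%R * a.1 + e 1%R * a.2)%N s & size s = M]) ->
  (2 * NGamma G - 1 <= N)%N ->
  exists f : 'cV[R[i]]_2 -> 'cV[R[i]]_N,
    [/\ smooth_CR_map f, nonconstant_on_sphere f,
        forall g z, g \in G -> sphere z -> f (g *m z)%R = f z
      & minimal_embedding f].
Proof.
move=> Pu wp e0 GE Fid Fdeg ut tF t1 sizes NG.
have tG : (size t <= NGamma G)%N.
  by apply: (NGamma_ge wp e0 Pu GE Fid Fdeg ut) => a; rewrite tF.
have [|s [us s1 sinv sN]] := sizes N; first by lia.
have [c [c0 c1]] := unital_weights us s1.
have N1 : (1 < size s)%N by lia.
subst N; exists (monomial_map P c s).
have fmin := monomial_map_minimal Pu c0 us.
split; last exact: fmin.
- split=> [z|i]; last exact: monomial_map_CR.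
  exact: monomial_map_sphere.
- by apply: nonconstant_minimal => //; apply: sphere2_inhabited.
- move=> g z gG _.
  apply: (@monomial_map_invariant R P c s Pu p w e g z (prim_expr_order wp) sinv).
  have : [set` G] g by [].
  by rewrite GE => -[_ /(cyclic_genP e wp)[k _ ->] <-]; exists k.
Qed.

Theorem theorem2 (R : realType) (Gamma : {fset 'M[R[i]]_2})
    (hGamma : admissible Gamma) (N : nat) (hN : (2 * NGamma Gamma - 1 <= N)%N) :
  exists f : 'cV[R[i]]_2 -> 'cV[R[i]]_N,
    [/\ smooth_CR_map f,
        nonconstant_on_sphere f,
        forall g z, g \in Gamma -> sphere z -> f (g *m z)%R = f z
      & minimal_embedding f].
Proof.
have [_ [p [w [wp [[P Pu GE]|[op [P Pu GE]]]]]]] := hGamma;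
  have p0 := prim_order_gt0 wp.
- have [t [ut tF st]] := binom_exponents p.
  apply: (@exists_invariant_map R Gamma P p w (fun=> 1%N) (binom_terms p) t N
    Pu wp erefl _ _ _ ut tF _ _ hN).
  + rewrite GE; suff -> : diag_gen w (fun=> 1%N) = w%:M by [].
    by apply/matrixP => i j; rewrite !mxE expr1.
  + move=> x y; rewrite -(prod_one_sub_binom (zz_scalar R) wp); apply: eq_bigr => k _.
    by rewrite muln1.
  + by move=> [a b]; rewrite mem_binom => /eqP /= ->.
  + by rewrite st.
  + rewrite st => M pM; have [s [us s1 sinv sM]] := unital_binom_sizes R p0 pM.
    exists s; split=> //; apply/allP => a sa; rewrite !mul1n.
    exact: (allP sinv).
- have [t [ut tF st]] := lucas_exponents op.
  apply: (@exists_invariant_map R Gamma P p w (fun j => j.+1)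
    ((0, p)%N :: lucas_terms p) t N Pu wp erefl GE _ _ ut tF _ _ hN).
  + move=> x y; rewrite -(prod_one_sub_lucas (zz_scalar R) wp _ _ op); apply: eq_bigr => k _.
    by rewrite muln1 mulnC.
  + by move=> [a b]; rewrite inE mem_lucas xpair_eqE /=; lia.
  + by rewrite st.
  + rewrite st => M pM; have [s [us s1 sinv sM]] := unital_lucas_sizes R op pM.
    exists s; split=> //; apply/allP => a sa; rewrite mul1n.
    exact: (allP sinv).
Qed.
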